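(* Let $1,i,j,k\in M_2(\mathbb C)$ denote the matrices $$1=\begin{pmatrix}1&0\\ 0&1\end{pmatrix},\quad i=\begin{pmatrix}\sqrt{-1}&0\\ 0&-\sqrt{-1}\end{pmatrix},\quad j=\begin{pmatrix}0&1\\ -1&0\end{pmatrix},\quad k=\begin{pmatrix}0&\sqrt{-1}\\ \sqrt{-1}&0\end{pmatrix}.$$ Equip $M_2(\mathbb C)$ with the inner product $\langle a,b\rangle=\frac12\mathrm{Tr}(ab^* )$, and for $y\in SU(2)$ let $P_y$ be the orthogonal projection of $M_2(\mathbb C)$ onto the line $\mathbb C y$, regarded as a continuous function of $y$ with values in the algebra $M_4(\mathbb C)$ of linear endomorphisms of $M_2(\mathbb C)\simeq\mathbb C^4$. Then there is an inner faithful $\mathbb C^*$-algebra representation $$\pi:A_{aut}(X_4)\to C(SU(2),M_4(\mathbb C))$$ mapping the universal $4\times4$ magic biunitary matrix $u=(u_{rs})$ (entrywise) to the $4\times 4$ matrix $v$ whose entries are the functions of $x\in SU(2)$ given by $$v(x)=\begin{pmatrix}P_x&P_{xi}&P_{xj}&P_{xk}\\ P_{ix}&P_{ixi}&P_{ixj}&P_{ixk}\\ P_{jx}&P_{jxi}&P_{jxj}&P_{jxk}\\ P_{kx}&P_{kxi}&P_{kxj}&P_{kxk}\end{pmatrix}.$$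
   Context: **Magic biunitaries.** Let $A$ be a unital $\mathbb C^*$-algebra. A projection is $p\in A$ with $p^2=p^*=p$. A partition of unity is a finite family of projections that are mutually orthogonal ($pq=0$) and sum to $1$. A matrix $v\in M_n(A)$ is called magic biunitary if each of its rows and each of its columns is a partition of unity of $A$. **The algebra $A_{aut}(X_n)$.** $A_{aut}(X_n)$, with $X_n=\{1,\dots,n\}$, is the universal unital $\mathbb C^*$-algebra generated by $n^2$ elements $u_{ij}$ subject to the relations making $u=(u_{ij})$ a magic biunitary matrix. This $u$ is the universal magic biunitary matrix. For every magic biunitary $v\in M_n(A)$ there is a unique unital $*$-homomorphism $A_{aut}(X_n)\to A$ mapping $u_{ij}\mapsto v_{ij}$. $A_{aut}(X_n)$ is a unital Hopf $\mathbb C^*$-algebra (a compact quantum group algebra in the sense of Woronowicz), with comultiplication $\Delta(u_{ij})=\sum_k u_{ik}\otimes u_{kj}$, counit $\varepsilon(u_{ij})=\delta_{ij}$ and antipode $S(u_{ij})=u_{ji}$. **Inner faithfulness.** Let $H$ be a unital Hopf $\mathbb C^*$-algebra and let $H_{alg}\subset H$ be its dense Hopf $*$-subalgebra spanned by the coefficients of finite dimensional corepresentations (for $H=A_{aut}(X_n)$ it is the $*$-algebra generated by the $u_{ij}$). The space $H_{alg}^*$ of all linear forms on $H_{alg}$ is a $*$-algebra, with product dual to the comultiplication, $fg=(f\otimes g)\Delta$, and involution $f^*(a)=\overline{f(S(a)^* )}$. A representation of $H$ is a unital $*$-homomorphism $\pi:H\to A$ into a unital $\mathbb C^*$-algebra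 $A$. Its coefficients are the linear forms $\varphi\circ\pi$ (restricted to $H_{alg}$) with $\varphi\in A^*$. The representation $\pi$ is called inner faithful if the $*$-subalgebra of $H_{alg}^*$ generated by its coefficients is dense in $H_{alg}^*$ for the weak topology (pointwise convergence on $H_{alg}$). *)

(* Defs.v *)
From HB Require Import structures.
From mathcomp Require Import all_boot all_order all_algebra.
From mathcomp Require Import perm sesquilinear spectral.
From mathcomp Require Import all_classical all_reals all_analysis.
From mathcomp.real_closed Require Import complex.
From mathcomp Require Import ring lra.
Set Implicit Arguments.
Unset Strict Implicit.
Unset Printing Implicit Defensive.

Import Order.TTheory GRing.Theory Num.Theory.
Import numFieldNormedType.Exports.
Local Open Scope classical_set_scope.
Local Open Scope ring_scope.
Local Open Scope sesquilinear_scope.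
Import ComplexField.

(* R[i] carries the topology of its norm. *)
HB.instance Definition _ (R : realType) :=
  PseudoPointedMetric.copy R[i] R[i]^o.
HB.instance Definition _ (R : realType) := NormedModule.copy R[i] R[i]^o.

Section Euclid.
Variable R : realType.
Local Notation C := R[i].

(* Hilbert space norm on C^n, and the associated operator norm. *)
Definition l2norm n (v : 'cV[C]_n) : R :=
  Num.sqrt (\sum_i Normc.normc (v i 0) ^+ 2).

Definition opnorm m n (A : 'M[C]_(m, n)) : R :=
  sup [set l2norm (A *m v) | v in [set v : 'cV[C]_n | l2norm v <= 1]].

Lemma normcE (z : C) : `|z| = (Normc.normc z)%:C%C.
Proof. by case: z. Qed.

Lemma normc_ge0 (z : C) : 0 <= Normc.normc z.
Proof. by case: z => a b; exact: sqrtr_ge0. Qed.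

Lemma l2normE n (v : 'cV[C]_n) : (l2norm v)%:C%C = sqrtC (dotmx v^T v^T).
Proof.
apply/eqP; rewrite -(@eqrXn2 _ 2) ?ler0c ?sqrtr_ge0 ?sqrtC_ge0 ?dnorm_ge0//.
apply/eqP; rewrite sqrtCK -rmorphXn/= sqr_sqrtr; last first.
  by apply: sumr_ge0 => i _; exact: sqr_ge0.
rewrite rmorph_sum/= dotmxE mxE; apply: eq_bigr => i _.
by rewrite !mxE rmorphXn/= -normcE normCK.
Qed.

Lemma l2norm_ge0 n (v : 'cV[C]_n) : 0 <= l2norm v.
Proof. exact: sqrtr_ge0. Qed.

Lemma l2norm_sqr n (v : 'cV[C]_n) : (l2norm v ^+ 2)%:C%C = dotmx v^T v^T.
Proof. by rewrite rmorphXn/= l2normE sqrtCK. Qed.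

Lemma l2normD n (u v : 'cV[C]_n) : l2norm (u + v) <= l2norm u + l2norm v.
Proof.
rewrite -lecR rmorphD/= !l2normE linearD/=.
exact: (triangle_lerif (@dotmx C n) u^T v^T).1.
Qed.

Lemma l2normZ n (c : C) (v : 'cV[C]_n) :
  l2norm (c *: v) = Normc.normc c * l2norm v.
Proof.
rewrite /l2norm; under eq_bigr do rewrite mxE Normc.normcM exprMn.
by rewrite -mulr_sumr sqrtrM ?sqr_ge0// sqrtr_sqr ger0_norm// normc_ge0.
Qed.

Lemma l2norm_coord n (v : 'cV[C]_n) i : Normc.normc (v i 0) <= l2norm v.
Proof.
rewrite -(ger0_norm (normc_ge0 _)) -sqrtr_sqr ler_wsqrtr//.
by rewrite (bigD1 i)//= lerDl sumr_ge0// => j _; rewrite sqr_ge0.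
Qed.

Lemma l2norm0 n : l2norm (0 : 'cV[C]_n) = 0.
Proof.
rewrite /l2norm big1 ?sqrtr0// => i _.
by rewrite mxE Normc.normc0 expr0n.
Qed.

Lemma l2norm_eq0 n (v : 'cV[C]_n) : l2norm v = 0 -> v = 0.
Proof.
move=> v0; apply/colP => i; rewrite mxE; apply: Normc.eq0_normc.
by apply/eqP; rewrite eq_le normc_ge0 -[X in _ <= X]v0 l2norm_coord.
Qed.

Lemma l2norm_sum n (I : Type) (r : seq I) (F : I -> 'cV[C]_n) :
  l2norm (\sum_(i <- r) F i) <= \sum_(i <- r) l2norm (F i).
Proof.
elim/big_ind2 : _ => [|x a y b xa yb|//]; first by rewrite l2norm0.
exact: le_trans (l2normD _ _) (lerD xa yb).
Qed.

Lemma l2norm_delta n (j : 'I_n) : l2norm (delta_mx j 0 : 'cV[C]_n) = 1.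
Proof.
rewrite /l2norm (bigD1 j)//= big1 => [|i /negbTE ij].
  by rewrite mxE !eqxx Normc.normc1 expr1n addr0 sqrtr1.
by rewrite mxE ij Normc.normc0 expr0n.
Qed.

Lemma l2norm_mul_bound m n (A : 'M[C]_(m, n)) (v : 'cV[C]_n) :
  l2norm (A *m v) <= (\sum_j l2norm (col j A)) * l2norm v.
Proof.
have -> : A *m v = \sum_j v j 0 *: col j A.
  apply/colP => i; rewrite mxE summxE; apply: eq_bigr => j _.
  by rewrite !mxE mulrC.
apply: (le_trans (l2norm_sum _ _)); rewrite mulr_suml; apply: ler_sum => j _.
by rewrite l2normZ mulrC ler_wpM2l ?l2norm_ge0 ?l2norm_coord.
Qed.

Lemma opnorm_has_sup m n (A : 'M[C]_(m, n)) :
  has_sup [set l2norm (A *m v) | v in [set v : 'cV[C]_n | l2norm v <= 1]].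
Proof.
split; first by exists (l2norm (A *m 0)), 0 => //=; rewrite l2norm0.
exists (\sum_j l2norm (col j A)) => _ [v /= v1 <-].
apply: (le_trans (l2norm_mul_bound _ _)); rewrite ler_piMr// sumr_ge0//.
by move=> j _; exact: l2norm_ge0.
Qed.

Lemma opnorm_ge0 m n (A : 'M[C]_(m, n)) : 0 <= opnorm A.
Proof.
apply: (@le_trans _ _ (l2norm (A *m 0))); first exact: l2norm_ge0.
by apply: sup_ubound; [case: (opnorm_has_sup A)|exists 0 => //=; rewrite l2norm0].
Qed.

Lemma opnorm_le m n (A : 'M[C]_(m, n)) M :
  (forall v : 'cV[C]_n, l2norm v <= 1 -> l2norm (A *m v) <= M) ->
  opnorm A <= M.
Proof.
move=> AM; apply: ge_sup; first by case: (opnorm_has_sup A).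
by move=> _ [v /= v1 <-]; exact: AM.
Qed.

Lemma opnorm_ub m n (A : 'M[C]_(m, n)) v :
  l2norm (A *m v) <= opnorm A * l2norm v.
Proof.
have [v0|v0] := eqVneq (l2norm v) 0.
  by rewrite v0 (l2norm_eq0 v0) mulmx0 l2norm0 mulr0.
have vgt0 : 0 < l2norm v by rewrite lt_neqAle eq_sym v0 l2norm_ge0.
rewrite -ler_pdivrMr//.
have nc : Normc.normc ((l2norm v)^-1)%:C%C = (l2norm v)^-1.
  by apply: complexI; rewrite -normcE ger0_norm// ler0c invr_ge0 ltW.
rewrite mulrC -{1}nc -l2normZ scalemxAr.
apply: sup_ubound; first by case: (opnorm_has_sup A).
by exists (((l2norm v)^-1)%:C%C *: v) => //=; rewrite l2normZ nc mulVf.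
Qed.

Lemma opnorm_entry m n (A : 'M[C]_(m, n)) i j :
  Normc.normc (A i j) <= opnorm A.
Proof.
apply: le_trans (le_trans (opnorm_ub A (delta_mx j 0)) _).
  have -> : A i j = (A *m (delta_mx j 0 : 'cV_n)) i 0 by rewrite -colE mxE.
  exact: l2norm_coord.
by rewrite l2norm_delta mulr1.
Qed.

Lemma opnorm_le_sum m n (A : 'M[C]_(m, n)) :
  opnorm A <= \sum_j l2norm (col j A).
Proof.
apply: opnorm_le => v v1; apply: (le_trans (l2norm_mul_bound _ _)).
by rewrite ler_piMr// sumr_ge0// => j _; exact: l2norm_ge0.
Qed.

Lemma opnormD m n (A B : 'M[C]_(m, n)) : opnorm (A + B) <= opnorm A + opnorm B.
Proof.
apply: opnorm_le => v v1; rewrite mulmxDl.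
apply: le_trans (l2normD _ _) (lerD _ _); apply: le_trans (opnorm_ub _ _) _;
  by rewrite ler_piMr// opnorm_ge0.
Qed.

Lemma opnormM m n p (A : 'M[C]_(m, n)) (B : 'M[C]_(n, p)) :
  opnorm (A *m B) <= opnorm A * opnorm B.
Proof.
apply: opnorm_le => v v1; rewrite -mulmxA.
apply: le_trans (opnorm_ub _ _) _; rewrite ler_wpM2l ?opnorm_ge0//.
by apply: le_trans (opnorm_ub _ _) _; rewrite ler_piMr// opnorm_ge0.
Qed.

Lemma opnormZ_le m n c (A : 'M[C]_(m, n)) :
  opnorm (c *: A) <= Normc.normc c * opnorm A.
Proof.
apply: opnorm_le => v v1; rewrite -scalemxAl l2normZ ler_wpM2l ?normc_ge0//.
by apply: le_trans (opnorm_ub _ _) _; rewrite ler_piMr// opnorm_ge0.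
Qed.

Lemma opnormZ m n c (A : 'M[C]_(m, n)) :
  opnorm (c *: A) = Normc.normc c * opnorm A.
Proof.
have [->|c0] := eqVneq c 0.
  apply/eqP; rewrite eq_le opnormZ_le scale0r Normc.normc0 mul0r.
  exact: opnorm_ge0.
apply/eqP; rewrite eq_le opnormZ_le/=.
have n0 : Normc.normc c != 0 by apply: contra c0 => /eqP/Normc.eq0_normc ->.
have nc : 0 < Normc.normc c by rewrite lt_neqAle eq_sym n0 normc_ge0.
rewrite -[A in leLHS](scalerK c0) -ler_pdivlMl// -Normc.normcV.
exact: opnormZ_le.
Qed.

Lemma opnorm_eq0 m n (A : 'M[C]_(m, n)) : opnorm A = 0 -> A = 0.
Proof.
move=> A0; apply/matrixP => i j; rewrite mxE; apply: Normc.eq0_normc.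
by apply/eqP; rewrite eq_le normc_ge0 -[X in _ <= X]A0 opnorm_entry.
Qed.

Lemma opnorm_sqr_le m n (A : 'M[C]_(m, n)) :
  opnorm A ^+ 2 <= opnorm (A^t* *m A).
Proof.
rewrite -[leRHS](sqr_sqrtr (opnorm_ge0 _)) lerXn2r ?nnegrE ?opnorm_ge0 ?sqrtr_ge0//.
apply: opnorm_le => v v1.
rewrite -(ger0_norm (l2norm_ge0 (A *m v))) -sqrtr_sqr ler_wsqrtr//.
rewrite -lecR l2norm_sqr.
have E : dotmx (A *m v)^T (A *m v)^T = dotmx (A^t* *m A *m v)^T v^T.
  have E1 : ((A *m v)^T)^t* = map_mx Num.Def.conjC A *m (v^T)^t*.
    by rewrite !trmxK map_mxM.
  have E2 : (A^t* *m A *m v)^T = (A *m v)^T *m map_mx Num.Def.conjC A.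
    by rewrite -mulmxA trmx_mul -map_trmx trmxK.
  by rewrite !dotmxE E1 E2 mulmxA.
have d0 : 0 <= dotmx (A *m v)^T (A *m v)^T by exact: dnorm_ge0.
rewrite -(ger0_norm d0) E.
set w := A^t* *m A *m v.
have CS : `|dotmx w^T v^T| <= (l2norm w * l2norm v)%:C%C.
  rewrite [X in _ <= X]rmorphM/= !l2normE.
  exact: (CauchySchwarz_sqrt (@dotmx C n) _ _).1.
apply: (le_trans CS); rewrite lecR /w.
apply: (@le_trans _ _ (l2norm (A^t* *m A *m v))).
  by rewrite ler_piMr// l2norm_ge0.
by apply: le_trans (opnorm_ub _ _) _; rewrite ler_piMr// opnorm_ge0.
Qed.

Lemma opnorm_adj_le m n (A : 'M[C]_(m, n)) : opnorm A <= opnorm (A^t*).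
Proof.
have [->|A0] := eqVneq A 0.
  by apply: le_trans (opnorm_ge0 _); apply: opnorm_le => v _;
    rewrite mul0mx l2norm0.
have Agt0 : 0 < opnorm A.
  rewrite lt_neqAle opnorm_ge0 andbT eq_sym.
  by apply: contra A0 => /eqP/opnorm_eq0 ->.
rewrite -(ler_pM2r Agt0); apply: le_trans (opnorm_sqr_le A) _.
exact: opnormM.
Qed.

Lemma opnorm_adj m n (A : 'M[C]_(m, n)) : opnorm (A^t*) = opnorm A.
Proof.
apply/le_anti/andP; split; last exact: opnorm_adj_le.
by apply: le_trans (opnorm_adj_le _) _; rewrite trmxCK.
Qed.

Lemma opnorm_cstar m n (A : 'M[C]_(m, n)) :
  opnorm (A^t* *m A) = opnorm A ^+ 2.
Proof.
apply/le_anti/andP; split; last exact: opnorm_sqr_le.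
by apply: le_trans (opnormM _ _) _; rewrite opnorm_adj.
Qed.

End Euclid.

Section Continuity.
Variable C : numClosedFieldType.

Lemma mx_continuous (X : topologicalType) m n (f : X -> 'M[C]_(m, n)) :
  (forall i j, continuous (fun x => f x i j)) -> continuous f.
Proof.
move=> fc x A [P Pf PA]; apply: filterS PA _.
have : \forall y \near x, forall i j, P i j (f y i j).
  apply: filter_forall => i; apply: filter_forall => j.
  exact: (fc i j x _ (Pf i j)).
by [].
Qed.

Lemma conj_continuous : continuous (fun z : C => z^*).
Proof.
move=> z A [e e0 eA]; exists e => // y zy; apply: eA.
by rewrite /ball_/= -rmorphB norm_conjC.
Qed.

Lemma sum_continuous (X : topologicalType) (I : Type) (r : seq I)
    (F : I -> X -> C) : (forall i, continuous (F i)) ->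
  continuous (fun x => \sum_(i <- r) F i x).
Proof.
move=> Fc x; rewrite /continuous_at; elim: r => [|i r IHr].
  by rewrite big_nil; under eq_fun do rewrite big_nil; exact: cvg_cst.
under eq_fun do rewrite big_cons.
by rewrite big_cons; apply: cvgD => //; exact: Fc.
Qed.

Lemma prod_continuous (X : topologicalType) (I : Type) (r : seq I)
    (F : I -> X -> C) : (forall i, continuous (F i)) ->
  continuous (fun x => \prod_(i <- r) F i x).
Proof.
move=> Fc x; rewrite /continuous_at; elim: r => [|i r IHr].
  by rewrite big_nil; under eq_fun do rewrite big_nil; exact: cvg_cst.
under eq_fun do rewrite big_cons.
by rewrite big_cons; apply: cvgM => //; exact: Fc.
Qed.
Lemma lincomb_continuous (X : topologicalType) (c : C) (f g : X -> C) :
  continuous f -> continuous g -> continuous (fun x => f x + c * g x).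
Proof.
move=> fc gc x; rewrite /continuous_at; apply: cvgD; first exact: fc.
by apply: cvgM; [exact: cvg_cst|exact: gc].
Qed.

Lemma entry_continuous (X : topologicalType) m n (f : X -> 'M[C]_(m, n)) i j :
  continuous f -> continuous (fun x => f x i j).
Proof.
move=> fc x; apply: (@continuous_comp _ _ _ f (fun M : 'M[C]_(m, n) => M i j)).
  exact: fc.
exact: coord_continuous.
Qed.

Lemma mulmx_continuous (X : topologicalType) m n p (f : X -> 'M[C]_(m, n))
    (g : X -> 'M[C]_(n, p)) :
  continuous f -> continuous g -> continuous (fun x => f x *m g x).
Proof.
move=> fc gc; apply: mx_continuous => i j.
under eq_fun do rewrite mxE.
apply: sum_continuous => k x; rewrite /continuous_at.
by apply: cvgM; exact: entry_continuous.
Qed.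

Lemma lincombmx_continuous (X : topologicalType) m n (c : C)
    (f g : X -> 'M[C]_(m, n)) :
  continuous f -> continuous g -> continuous (fun x => f x + c *: g x).
Proof.
move=> fc gc; apply: mx_continuous => i j.
under eq_fun do rewrite !mxE.
by apply: lincomb_continuous; exact: entry_continuous.
Qed.

Lemma adjmx_continuous (X : topologicalType) m n (f : X -> 'M[C]_(m, n)) :
  continuous f -> continuous (fun x => (f x)^t*).
Proof.
move=> fc; apply: mx_continuous => i j.
under eq_fun do rewrite !mxE.
move=> x; apply: (@continuous_comp _ _ _ (fun x => f x j i) (fun z : C => z^*)).
  exact: entry_continuous.
exact: conj_continuous.
Qed.

Lemma det_continuous n : continuous (fun A : 'M[C]_n => \det A).
Proof.
apply: sum_continuous => s; rewrite (_ : (fun x => _) =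
    (fun A : 'M[C]_n => 0 + (-1) ^+ s * \prod_i A i (s i))); last first.
  by apply/funext => A; rewrite add0r.
apply: (@lincomb_continuous _ _ (fun=> 0)); first exact: cst_continuous.
by apply: prod_continuous => i; exact: coord_continuous.
Qed.

Lemma special_unitary_closed n :
  closed [set x : 'M[C]_n | x \is unitarymx /\ \det x = 1].
Proof.
have -> : [set x : 'M[C]_n | x \is unitarymx /\ \det x = 1] =
    (fun x => x *m x^t*) @^-1` [set 1%:M] `&`
    (fun x : 'M[C]_n => \det x) @^-1` [set 1].
  by apply/seteqP; split => x [/unitarymxP ? ?].
have cl1 (T : normedModType C) (x : T) : closed [set x].
  exact/accessible_closed_set1/hausdorff_accessible/norm_hausdorff.
refine (closedI (preimage_closed _ (cl1 _ _)) (preimage_closed _ (cl1 _ _))).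
  move=> x _; apply: mulmx_continuous; first by move=> ?; exact: cvg_id.
  by apply: adjmx_continuous => ?; exact: cvg_id.
by move=> x _; exact: det_continuous.
Qed.

End Continuity.

Definition SU (R : realType) n : set 'M[R[i]]_n :=
  [set x | x \is unitarymx /\ \det x = 1].
Arguments SU : clear implicits.

Section Compactness.
Variable R : realType.
Local Notation C := R[i].

Lemma real_complex_continuous : continuous (fun x : R => x%:C%C : C).
Proof.
move=> x A [e /=]; rewrite ltcE => /andP[/eqP ie0 re0] eA.
apply/nbhs_ballP; exists (complex.Re e) => // y xy; apply: eA.
rewrite /ball_/= -rmorphB normcE ltcE/= ie0 eqxx/=.
by rewrite expr0n/= addr0 sqrtr_sqr.
Qed.

Lemma ReIm_continuous : continuous (fun p : R * R => (p.1 +i* p.2)%C : C).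
Proof.
have -> : (fun p : R * R => (p.1 +i* p.2)%C) =
    (fun p => p.1%:C%C + 'i%C * p.2%:C%C).
  by apply/funext => p; rewrite [LHS]complexE.
apply: (@lincomb_continuous R[i]) => p.
  apply: (@continuous_comp _ _ _ fst (fun x : R => x%:C%C)).
    exact: cvg_fst.
  exact: real_complex_continuous.
apply: (@continuous_comp _ _ _ snd (fun x : R => x%:C%C)).
  exact: cvg_snd.
exact: real_complex_continuous.
Qed.

Lemma normc_ge_ReIm (z : C) :
  `|complex.Re z| <= Normc.normc z /\ `|complex.Im z| <= Normc.normc z.
Proof.
case: z => a b /=; rewrite -!sqrtr_sqr.
by split; rewrite ler_wsqrtr// ?lerDl ?lerDr sqr_ge0.
Qed.

Lemma complex_cauchy (u : nat -> C) :
  (forall e : R, 0 < e ->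
    \forall p \near \oo & q \near \oo, Normc.normc (u p - u q) < e) ->
  exists l : C, u @ \oo --> l.
Proof.
move=> uc.
have cR (v : nat -> R) : (forall e : R, 0 < e ->
    \forall p \near \oo & q \near \oo, `|v p - v q| < e) -> cvg (v @ \oo).
  move=> H; apply: cauchy_cvg; apply/cauchy_ballP => e e0.
  by rewrite near_map2; exact: H.
have c1 : cvg ((fun n => complex.Re (u n)) @ \oo).
  apply: cR => e /uc; apply: filterS => -[p q] /=; apply: le_lt_trans.
  have [+ _] := normc_ge_ReIm (u p - u q).
  by case: (u p) (u q) => [? ?] [? ?].
have c2 : cvg ((fun n => complex.Im (u n)) @ \oo).
  apply: cR => e /uc; apply: filterS => -[p q] /=; apply: le_lt_trans.
  have [_] := normc_ge_ReIm (u p - u q).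
  by case: (u p) (u q) => [? ?] [? ?].
pose l : R * R := (lim ((fun n => complex.Re (u n)) @ \oo),
                   lim ((fun n => complex.Im (u n)) @ \oo)).
exists (l.1 +i* l.2)%C.
rewrite (_ : u = (fun p : R * R => (p.1 +i* p.2)%C : C) \o
    (fun n => (complex.Re (u n), complex.Im (u n)))); last first.
  by apply/funext => n /=; case: (u n).
suff : (fun n => (complex.Re (u n), complex.Im (u n))) @ \oo --> l.
  by move/cvg_comp; apply; exact: ReIm_continuous.
exact: (cvg_pair c1 c2).
Qed.

Lemma SU_entry n (x : 'M[C]_n) i j : SU R n x -> Normc.normc (x i j) <= 1.
Proof.
move=> [/unitarymxP xx _].
have := opnorm_cstar (x^t*); rewrite trmxCK xx => x1.
have {}x1 : opnorm (x^t*) ^+ 2 <= 1.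
  by rewrite -x1; apply: opnorm_le => v v1; rewrite mul1mx.
apply: (le_trans (opnorm_entry _ _ _)); rewrite -opnorm_adj.
by rewrite -(@expr_le1 _ 2)// opnorm_ge0.
Qed.

Lemma SU_compact n : compact (SU R n).
Proof.
pose Q : set C := (fun p : R * R => (p.1 +i* p.2)%C) @`
  (`[-1, 1]%classic `*` `[-1, 1]%classic).
have Qc : compact Q.
  apply: continuous_compact.
    by apply: continuous_subspaceT; exact: ReIm_continuous.
  by apply: compact_setX; exact: segment_compact.
have Bc : compact (vec_mx @` [set v : 'rV[C]_(n * n) | forall i, Q (v 0 i)]).
  apply: continuous_compact; last exact: (@rV_compact C _ (fun=> Q) (fun=> Qc)).
  apply: continuous_subspaceT; apply: (@mx_continuous R[i]) => i j.
  by under eq_fun do rewrite mxE; exact: coord_continuous.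
apply: (subclosed_compact _ Bc); last first.
  move=> x xSU; exists (mxvec x); last exact: mxvecK.
  move=> k; case/mxvec_indexP: k => i j; rewrite mxvecE.
  exists (complex.Re (x i j), complex.Im (x i j)); last by case: (x i j).
  have [a b] := normc_ge_ReIm (x i j); have x1 := SU_entry i j xSU.
  by split => /=; rewrite in_itv/= -ler_norml; [exact: le_trans a x1|exact: le_trans b x1].
exact: (@special_unitary_closed R[i]).
Qed.

Lemma normc_continuous : continuous (fun z : C => Normc.normc z).
Proof.
move=> z A /nbhs_ballP[e e0 eA]; exists e%:C%C; first by rewrite /= ltcR.
move=> y zy; apply: eA.
have dist (a b : C) : Normc.normc a - Normc.normc b <= Normc.normc (a - b).
  by rewrite -lecR rmorphB/= -!normcE lerB_dist.
rewrite /ball/= ltr_norml ltrNl opprB; move: zy; rewrite /ball_/= normcE ltcR.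
move=> zy; rewrite !(le_lt_trans (dist _ _))//.
by rewrite -ltcR -normcE distrC normcE ltcR.
Qed.

Lemma opnorm_le_entries m n (A : 'M[C]_(m, n)) :
  opnorm A <= \sum_j \sum_i Normc.normc (A i j).
Proof.
apply: (le_trans (opnorm_le_sum _)); apply: ler_sum => j _.
rewrite (_ : col j A = \sum_i A i j *: delta_mx i 0); last first.
  by rewrite [LHS]matrix_sum_delta; apply: eq_bigr => i _;
    rewrite big_ord1 !mxE.
apply: (le_trans (l2norm_sum _ _)); apply: ler_sum => i _.
by rewrite l2normZ l2norm_delta mulr1.
Qed.

Lemma continuous_normcP (X : topologicalType) (g : X -> C) :
  continuous g <-> forall x (e : R), 0 < e ->
    \forall y \near x, Normc.normc (g x - g y) < e.
Proof.
split=> [gc x e e0|gc x A [e /=]].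
  have : nbhs (g x) [set z | Normc.normc (g x - z) < e].
    exists e%:C%C; first by rewrite /= ltcR.
    by move=> z; rewrite /ball_/= normcE ltcR.
  exact: gc.
rewrite ltcE => /andP[/eqP ie0 re0] eA.
have : \forall y \near x, Normc.normc (g x - g y) < complex.Re e by exact: gc.
apply: filterS => y xy; apply: eA; rewrite /ball_/= normcE.
by rewrite ltcE/= ie0 eqxx.
Qed.

Lemma SU_bounded n p (f : SU R n -> 'M[C]_p) : continuous f ->
  exists M : R, forall x, opnorm (f x) <= M.
Proof.
move=> fc.
have entry i j : exists M : R, forall x, Normc.normc (f x i j) <= M.
  pose g (x : SU R n) := Normc.normc (f x i j).
  have gc : continuous g.
    move=> x; apply: (@continuous_comp _ _ _ (fun x => f x i j) (@Normc.normc R)).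
      exact: (@entry_continuous R[i]).
    exact: normc_continuous.
  have /continuous_compact/(_ (@SU_compact n)) : {within SU R n, continuous (valL g)}.
    exact/subspace_valL_continuousP.
  move=> /compact_bounded[M [_ /(_ (M + 1))]]; rewrite ltrDl => /(_ ltr01) MP.
  exists (M + 1) => x; apply: le_trans (ler_norm _) (MP _ _).
  exists (\val x); first exact: set_valP.
  exact: (congr1 (@^~ x) (@valLK _ _ point (SU R n) g)).
pose M i j := projT1 (cid (entry i j)).
exists (\sum_j \sum_i M i j) => x.
apply: (le_trans (opnorm_le_entries _)).
by apply: ler_sum => j _; apply: ler_sum => i _; rewrite /M; case: cid.
Qed.

End Compactness.

HB.mixin Record isStarAlgebra (R : realType) A of GRing.Algebra R[i] A := {
  star : A -> A;
  starK : involutive star;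
  starD : {morph star : a b / a + b};
  starZ : forall (c : R[i]) a, star (c *: a) = c^* *: star a;
  starM : forall a b, star (a * b) = star b * star a
}.

#[short(type="starAlgType")]
HB.structure Definition StarAlgebra (R : realType) :=
  {A of GRing.Algebra R[i] A & isStarAlgebra R A}.

(* The norm is real-valued and is a field of its own: Hierarchy Builder cannot
   join the normed modules over R[i] with the noncommutative rings, both being
   already joined in [Num.NumDomain]. *)
HB.mixin Record StarAlgebra_isCstar (R : realType) A of StarAlgebra R A := {
  cnorm : A -> R;
  cnormD : forall a b, cnorm (a + b) <= cnorm a + cnorm b;
  cnormZ : forall (c : R[i]) a, cnorm (c *: a) = Normc.normc c * cnorm a;
  cnorm0_eq0 : forall a, cnorm a = 0 -> a = 0;
  cnormM : forall a b, cnorm (a * b) <= cnorm a * cnorm b;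
  cnorm_starM : forall a, cnorm (star a * a) = cnorm a ^+ 2;
  cnorm_complete : forall u : nat -> A,
    (forall e : R, 0 < e ->
      \forall p \near \oo & q \near \oo, cnorm (u p - u q) < e) ->
    exists l : A, cnorm (u n - l) @[n --> \oo] --> 0
}.

#[short(type="cstarAlgType")]
HB.structure Definition CstarAlgebra (R : realType) :=
  {A of StarAlgebra R A & StarAlgebra_isCstar R A}.

(* C(SU(2), M_4(C)) with pointwise operations, the conjugate transpose as
   involution and the supremum of the operator norms as norm. *)
Definition CSU2M4 (R : realType) := continuousType (SU R 2) 'M[R[i]]_4.

Section CSU2M4.
Variable R : realType.
Local Notation C := R[i].
Local Notation X := (SU R 2).
Local Notation T := (CSU2M4 R).
Implicit Types f g h : T.

HB.instance Definition _ := Choice.copy T (continuousType X 'M[C]_4).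

Lemma CSU2M4P f g : (forall x, f x = g x) -> f = g.
Proof. by move=> fg; apply/continuousEP. Qed.

Let ctsD f g : continuous (fun x => f x + g x).
Proof.
rewrite (_ : (fun x => _) = (fun x => f x + 1 *: g x)); last first.
  by apply/funext => x; rewrite scale1r.
by apply: (@lincombmx_continuous C); exact: cts_fun.
Qed.

Let ctsZ c f : continuous (fun x => c *: f x).
Proof.
rewrite (_ : (fun x => _) = (fun x => 0 + c *: f x)); last first.
  by apply/funext => x; rewrite add0r.
by apply: (@lincombmx_continuous C); [exact: cst_continuous|exact: cts_fun].
Qed.

Let ctsN f : continuous (fun x => - f x).
Proof.
by under eq_fun do rewrite -scaleN1r; exact: ctsZ.
Qed.

Let ctsM f g : continuous (fun x => f x *m g x).
Proof. by apply: (@mulmx_continuous C); exact: cts_fun. Qed.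

Let cts_adj f : continuous (fun x => (f x)^t*).
Proof. by apply: (@adjmx_continuous C); exact: cts_fun. Qed.

Let ctsC (A : 'M[C]_4) : continuous (fun _ : X => A).
Proof. exact: cst_continuous. Qed.

Let add f g : T := mkcts (@ctsD f g).
Let opp f : T := mkcts (@ctsN f).
Let mul f g : T := mkcts (@ctsM f g).
Let scl c f : T := mkcts (@ctsZ c f).
Let adj f : T := mkcts (@cts_adj f).
Let cst A : T := mkcts (@ctsC A).

Let addA : associative add.
Proof. by move=> f g h; apply: CSU2M4P => x /=; rewrite /mkcts addrA. Qed.
Let addC : commutative add.
Proof. by move=> f g; apply: CSU2M4P => x /=; rewrite /mkcts addrC. Qed.
Let add0 : left_id (cst 0) add.
Proof. by move=> f; apply: CSU2M4P => x /=; rewrite /mkcts add0r. Qed.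
Let addN : left_inverse (cst 0) opp add.
Proof. by move=> f; apply: CSU2M4P => x /=; rewrite /mkcts addNr. Qed.

HB.instance Definition _ := GRing.isZmodule.Build T addA addC add0 addN.

Let mulA : associative mul.
Proof. by move=> f g h; apply: CSU2M4P => x /=; rewrite /mkcts mulmxA. Qed.
Let mul1 : left_id (cst 1%:M) mul.
Proof. by move=> f; apply: CSU2M4P => x /=; rewrite /mkcts mul1mx. Qed.
Let mulr_1 : right_id (cst 1%:M) mul.
Proof. by move=> f; apply: CSU2M4P => x /=; rewrite /mkcts mulmx1. Qed.
Let mul_Dl : left_distributive mul add.
Proof. by move=> f g h; apply: CSU2M4P => x /=; rewrite /mkcts mulmxDl. Qed.
Let mul_Dr : right_distributive mul add.
Proof. by move=> f g h; apply: CSU2M4P => x /=; rewrite /mkcts mulmxDr. Qed.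

Lemma SU1 n : 1%:M \in SU R n.
Proof.
rewrite inE; split; last exact: det1.
by apply/unitarymxP; rewrite trmx1 map_mx1 mulmx1.
Qed.

Let x1 : X := exist (fun x => x \in X) 1%:M (SU1 2).

Let one_neq0 : cst 1%:M != cst 0.
Proof.
apply/eqP => /(congr1 (fun f : T => f x1 0 0))/=.
by rewrite /mkcts !mxE/= => /eqP; rewrite oner_eq0.
Qed.

HB.instance Definition _ := GRing.Zmodule_isNzRing.Build T
  mulA mul1 mulr_1 mul_Dl mul_Dr one_neq0.

Let sclA a b f : scl a (scl b f) = scl (a * b) f.
Proof. by apply: CSU2M4P => x /=; rewrite /mkcts scalerA. Qed.
Let scl1 : left_id 1 scl.
Proof. by move=> f; apply: CSU2M4P => x /=; rewrite /mkcts scale1r. Qed.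
Let sclDr : right_distributive scl +%R.
Proof. by move=> a f g; apply: CSU2M4P => x /=; rewrite /mkcts scalerDr. Qed.
Let sclDl f : {morph scl^~ f : a b / a + b}.
Proof. by move=> a b; apply: CSU2M4P => x /=; rewrite /mkcts scalerDl. Qed.

HB.instance Definition _ := GRing.Zmodule_isLmodule.Build C T
  sclA scl1 sclDr sclDl.

Let scl_Al (a : C) f g : a *: (f * g) = a *: f * g.
Proof. by apply: CSU2M4P => x /=; rewrite /mkcts -scalemxAl. Qed.
HB.instance Definition _ := GRing.Lmodule_isLalgebra.Build C T scl_Al.

Let scl_Ar (a : C) f g : a *: (f * g) = f * (a *: g).
Proof. by apply: CSU2M4P => x /=; rewrite /mkcts -scalemxAr. Qed.
HB.instance Definition _ := GRing.Lalgebra_isAlgebra.Build C T scl_Ar.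

Let adjK : involutive adj.
Proof. by move=> f; apply: CSU2M4P => x /=; rewrite /mkcts/= trmxCK. Qed.
Let adjD : {morph adj : f g / f + g}.
Proof.
by move=> f g; apply: CSU2M4P => x /=; rewrite /mkcts/= linearD/= map_mxD.
Qed.
Let adjZ (c : C) f : adj (c *: f) = c^* *: adj f.
Proof.
by apply: CSU2M4P => x /=; rewrite /mkcts/= linearZ/= map_mxZ.
Qed.
Let adjM f g : adj (f * g) = adj g * adj f.
Proof.
by apply: CSU2M4P => x /=; rewrite /mkcts/= trmx_mul map_mxM.
Qed.
HB.instance Definition _ := isStarAlgebra.Build R T adjK adjD adjZ adjM.

Definition supnorm f : R := sup [set opnorm (f x) | x in [set: X]].

Let supnorm_has_sup f : has_sup [set opnorm (f x) | x in [set: X]].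
Proof.
split; first by exists (opnorm (f x1)), x1.
have [M fM] := SU_bounded (@cts_fun _ _ f).
by exists M => _ [x _ <-].
Qed.

Lemma supnorm_ub f x : opnorm (f x) <= supnorm f.
Proof. by apply: sup_ubound; [case: (supnorm_has_sup f)|exists x]. Qed.

Lemma supnorm_le f M : (forall x, opnorm (f x) <= M) -> supnorm f <= M.
Proof.
move=> fM; apply: ge_sup; first by case: (supnorm_has_sup f).
by move=> _ [x _ <-].
Qed.

Let supnorm_ge0 f : 0 <= supnorm f.
Proof. exact: le_trans (opnorm_ge0 _) (supnorm_ub f x1). Qed.

Let supnormD f g : supnorm (f + g) <= supnorm f + supnorm g.
Proof.
apply: supnorm_le => x; apply: (le_trans (opnormD _ _)).
by apply: lerD; exact: supnorm_ub.
Qed.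

Let supnormZ_le (c : C) f : supnorm (c *: f) <= Normc.normc c * supnorm f.
Proof.
apply: supnorm_le => x; rewrite [leLHS]opnormZ.
by rewrite ler_wpM2l ?normc_ge0// supnorm_ub.
Qed.

Let supnormZ (c : C) f : supnorm (c *: f) = Normc.normc c * supnorm f.
Proof.
apply/le_anti/andP; split; first exact: supnormZ_le.
have [->|c0] := eqVneq c 0.
  by rewrite Normc.normc0 mul0r; exact: supnorm_ge0.
have n0 : Normc.normc c != 0 by apply: contra c0 => /eqP/Normc.eq0_normc ->.
have nc : 0 < Normc.normc c by rewrite lt_neqAle eq_sym n0 normc_ge0.
rewrite -[f in leLHS](scalerK c0) -ler_pdivlMl// -Normc.normcV.
exact: supnormZ_le.
Qed.

Let supnorm_eq0 f : supnorm f = 0 -> f = 0.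
Proof.
move=> f0; apply: CSU2M4P => x; apply: opnorm_eq0.
by apply/le_anti/andP; split; [rewrite -f0 supnorm_ub|exact: opnorm_ge0].
Qed.

Let supnormM f g : supnorm (f * g) <= supnorm f * supnorm g.
Proof.
apply: supnorm_le => x; apply: (le_trans (opnormM _ _)).
by apply: ler_pM; rewrite ?opnorm_ge0 ?supnorm_ub.
Qed.

Let supnorm_star f : supnorm (star f * f) = supnorm f ^+ 2.
Proof.
apply/le_anti/andP; split.
  apply: supnorm_le => x; rewrite [leLHS]opnorm_cstar.
  by rewrite lerXn2r ?nnegrE ?opnorm_ge0 ?supnorm_ge0 ?supnorm_ub.
rewrite -[leRHS](sqr_sqrtr (supnorm_ge0 _)).
rewrite lerXn2r ?nnegrE ?supnorm_ge0 ?sqrtr_ge0//.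
apply: supnorm_le => x; rewrite -(ger0_norm (opnorm_ge0 (f x))) -sqrtr_sqr.
rewrite ler_wsqrtr// -opnorm_cstar.
exact: (supnorm_ub (star f * f) x).
Qed.

Let supnorm_complete (u : nat -> T) :
  (forall e : R, 0 < e ->
    \forall p \near \oo & q \near \oo, supnorm (u p - u q) < e) ->
  exists l : T, supnorm (u n - l) @[n --> \oo] --> 0.
Proof.
move=> uc.
have entry p q x i j : Normc.normc (u p x i j - u q x i j) <= supnorm (u p - u q).
  apply: le_trans (supnorm_ub _ x).
  apply: le_trans (opnorm_entry _ i j).
  by rewrite !mxE.
have lims x i j : exists l : C, (u n x i j) @[n --> \oo] --> l.
  apply: complex_cauchy => e /uc; apply: filterS => -[p q] /=.
  exact/le_lt_trans/entry.
pose l x := \matrix_(i, j) projT1 (cid (lims x i j)).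
have limP x i j : (u n x i j) @[n --> \oo] --> l x i j.
  by rewrite mxE; case: cid.
clearbody l; clear lims.
have lim0 x (e : R) : 0 < e -> \forall n \near \oo, opnorm (u n x - l x) < e.
  move=> e0; have e16 : 0 < e / 17 by rewrite divr_gt0.
  have : \forall n \near \oo, forall i j,
      Normc.normc (u n x i j - l x i j) < e / 17.
    apply: filter_forall => i; apply: filter_forall => j.
    have : nbhs (l x i j) [set z | Normc.normc (z - l x i j) < e / 17].
      exists (e / 17)%:C%C; first by rewrite /= ltcR.
      by move=> z; rewrite /ball_/= distrC normcE ltcR.
    exact: limP.
  apply: filterS => n nP; apply: (le_lt_trans (opnorm_le_entries _)).
  apply: (@le_lt_trans _ _ (\sum_(j < 4) \sum_(i < 4) e / 17)).
    by apply: ler_sum => j _; apply: ler_sum => i _; rewrite !mxE ltW.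
  rewrite !sumr_const !card_ord -mulrnA -[ltLHS]mulr_natr.
  by rewrite -mulrA gtr_pMr// mulrC ltr_pdivrMr// mul1r ltr_nat.
have unif (e : R) : 0 < e ->
    \forall n \near \oo, forall x, opnorm (u n x - l x) <= e.
  move=> e0; have /uc[[P Q] /= [P0 Q0] PQ] := divr_gt0 e0 (@ltr0Sn R 1).
  apply: filterS P0 => n Pn x.
  have [p [Qp pl]] := filter_ex (filterI Q0 (lim0 x _ (divr_gt0 e0 (@ltr0Sn R 1)))).
  rewrite -(subrK (u p x) (u n x)) -addrA.
  apply: (le_trans (opnormD _ _)); rewrite [leRHS]splitr; apply: lerD; last exact: ltW.
  apply: le_trans (ltW (PQ (n, p) (conj Pn Qp))).
  exact: (supnorm_ub (u n - u p) x).
have lc : continuous l.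
  apply: (@mx_continuous C) => i j; apply/continuous_normcP => x e e0.
  have [n nP] := filter_ex (unif _ (divr_gt0 e0 (@ltr0Sn R 3))).
  have := (continuous_normcP (fun x => u n x i j)).1.
  move=> /(_ (@entry_continuous C _ _ _ _ i j (@cts_fun _ _ (u n)))).
  move=> /(_ x _ (divr_gt0 e0 (@ltr0Sn R 3))); apply: filterS => y xy.
  have nE z : Normc.normc (u n z i j - l z i j) <= e / 4.
    by apply: le_trans (nP z); apply: le_trans (opnorm_entry _ i j); rewrite !mxE.
  have tri (a b a' b' : C) (d : R) : Normc.normc (b - a) <= d ->
      Normc.normc (b' - a') <= d -> Normc.normc (b - b') < d ->
      Normc.normc (a - a') < d + d + d.
    move=> ba ba' bb; rewrite -ltcR -normcE.
    rewrite (_ : a - a' = (b - b') - (b - a) + (b' - a')); last first.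
      by ring.
    apply: (le_lt_trans (ler_normD _ _)); rewrite rmorphD/=.
    apply: ltr_leD; last by rewrite normcE lecR.
    apply: (le_lt_trans (ler_normB _ _)); rewrite rmorphD/=.
    by apply: ltr_leD; rewrite normcE ?ltcR ?lecR.
  apply: (lt_le_trans (tri _ _ _ _ _ (nE x) (nE y) xy)).
  rewrite -(@ler_pM2r _ 4)// !mulrDl !divfK//; lra.
exists (mkcts lc); apply/cvgrPdist_le => e e0.
apply: filterS (unif _ e0) => n nP.
by rewrite sub0r normrN ger0_norm ?supnorm_ge0//; exact: supnorm_le.
Qed.

HB.instance Definition _ := StarAlgebra_isCstar.Build R T
  supnormD supnormZ supnorm_eq0 supnormM supnorm_star supnorm_complete.

End CSU2M4.

Definition star_hom (R : realType) (A B : starAlgType R) (f : A -> B) : Prop :=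
  [/\ linear f, monoid_morphism f & forall a, f (star a) = star (f a)].

Section Magic.
Variables (R : realType) (A : starAlgType R).

Definition is_projection (p : A) : Prop := p ^+ 2 = p /\ star p = p.

Definition partition_of_unity (I : finType) (p : I -> A) : Prop :=
  [/\ forall i, is_projection (p i),
      forall i j, i != j -> p i * p j = 0 &
      \sum_i p i = 1].

Definition magic_biunitary n (v : 'M[A]_n) : Prop :=
  (forall i, partition_of_unity (fun j => v i j)) /\
  (forall j, partition_of_unity (fun i => v i j)).

End Magic.

(* The algebras B are nonzero, as [GRing.Algebra] requires 1 != 0; for B = 0
   the universal property would hold trivially. *)
Definition universal_magic (R : realType) (A : cstarAlgType R) n
    (u : 'M[A]_n) : Prop :=
  magic_biunitary u /\
  forall (B : cstarAlgType R) (v : 'M[B]_n), magic_biunitary v ->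
    exists! pi : A -> B, star_hom pi /\ map_mx pi u = v.

(* An element of the algebraic tensor product V (x) W is represented by a list
   of pairs [:: (v_1, w_1); ...; (v_k, w_k)] standing for the sum of the
   v_i (x) w_i. Two lists represent the same tensor iff every bilinear form
   takes the same value on them, bilinear forms on V x W being the linear
   forms on V (x) W; likewise with trilinear forms for triple tensors. *)
Section Tensors.
Variables (R : realType).
Implicit Types U V W : lmodType R[i].

Definition bilinear_form V W (B : V -> W -> R[i]) : Prop :=
  (forall w, scalar (fun v => B v w)) /\ (forall v, scalar (B v)).

Definition trilinear_form U V W (T : U -> V -> W -> R[i]) : Prop :=
  (forall w, bilinear_form (fun u v => T u v w)) /\
  (forall u, bilinear_form (T u)).

Definition tensor_eq V W (s t : seq (V * W)) : Prop :=
  forall B, bilinear_form B ->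
    \sum_(p <- s) B p.1 p.2 = \sum_(p <- t) B p.1 p.2.

End Tensors.

HB.mixin Record StarAlgebra_isHopf (R : realType) A of StarAlgebra R A := {
  comult : A -> seq (A * A);
  counit : A -> R[i];
  antipode : A -> A;
  comult_linear : forall (c : R[i]) a b,
    tensor_eq (comult (c *: a + b))
      ([seq (c *: p.1, p.2) | p <- comult a] ++ comult b);
  comult1 : tensor_eq (comult 1) [:: (1, 1)];
  comultM : forall a b,
    tensor_eq (comult (a * b))
      [seq (p.1 * q.1, p.2 * q.2) | p <- comult a, q <- comult b];
  comult_star : forall a,
    tensor_eq (comult (star a)) [seq (star p.1, star p.2) | p <- comult a];
  comultA : forall a (T : A -> A -> A -> R[i]), trilinear_form T ->
    \sum_(p <- comult a) \sum_(q <- comult p.1) T q.1 q.2 p.2 =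
    \sum_(p <- comult a) \sum_(q <- comult p.2) T p.1 q.1 q.2;
  counit_linear : scalar counit;
  counit_multiplicative : monoid_morphism counit;
  counit_star : forall a, counit (star a) = (counit a)^*;
  comult_counitl : forall a, \sum_(p <- comult a) counit p.1 *: p.2 = a;
  comult_counitr : forall a, \sum_(p <- comult a) counit p.2 *: p.1 = a;
  antipode_linear : linear antipode;
  antipodel : forall a, \sum_(p <- comult a) antipode p.1 * p.2 = (counit a)%:A;
  antipoder : forall a, \sum_(p <- comult a) p.1 * antipode p.2 = (counit a)%:A
}.

#[short(type="hopfStarAlgType")]
HB.structure Definition HopfStarAlgebra (R : realType) :=
  {A of StarAlgebra R A & StarAlgebra_isHopf R A}.

Definition matrix_comult (R : realType) (A : hopfStarAlgType R) n
    (w : 'M[A]_n) : Prop :=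
  forall i j, tensor_eq (comult (w i j)) [seq (w i k, w k j) | k <- enum 'I_n].

Definition corepresentation (R : realType) (A : hopfStarAlgType R) n
    (w : 'M[A]_n) : Prop :=
  matrix_comult w /\ forall i j, counit (w i j) = (i == j)%:R.

(* A unital Hopf C^*-algebra together with its dense Hopf *-subalgebra, given
   as an abstract Hopf *-algebra [halg] embedded by [hincl]. *)
Record hopfCstar (R : realType) := HopfCstar {
  hcstar :> cstarAlgType R;
  halg : hopfStarAlgType R;
  hincl : halg -> hcstar;
  hincl_hom : star_hom hincl;
  hincl_inj : injective hincl;
  hincl_dense : forall (x : hcstar) (e : R), 0 < e ->
    exists a, cnorm (x - hincl a) < e;
  halg_coef : forall a : halg,
    exists n (w : 'M[halg]_n) (c : 'M[R[i]]_n),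
      corepresentation w /\ a = \sum_i \sum_j c i j *: w i j
}.
Arguments hincl {R h}.

Definition unital_star_subalgebra (R : realType) (A : starAlgType R)
    (S : set A) : Prop :=
  [/\ S 1, forall (c : R[i]) a b, S a -> S b -> S (c *: a + b),
      forall a b, S a -> S b -> S (a * b) & forall a, S a -> S (star a)].

(* (H, u) is A_aut(X_n) with its universal magic biunitary matrix; [u] has
   entries in the dense Hopf *-subalgebra, which it generates. *)
Definition is_A_aut (R : realType) n (H : hopfCstar R) (u : 'M[halg H]_n) :
    Prop :=
  [/\ universal_magic (map_mx hincl u),
      smallest (@unital_star_subalgebra R (halg H))
        [set u ij.1 ij.2 | ij in [set: 'I_n * 'I_n]] = [set: halg H],
      matrix_comult u,
      forall i j, counit (u i j) = (i == j)%:R &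
      forall i j, antipode (u i j) = u j i].

Section InnerFaithful.
Variables (R : realType) (H : hopfCstar R).
Implicit Types f g : halg H -> R[i].

Definition linear_forms : set (halg H -> R[i]) := [set f | scalar f].

Definition convolution f g : halg H -> R[i] :=
  fun a => \sum_(p <- comult a) f p.1 * g p.2.

Definition form_star f : halg H -> R[i] :=
  fun a => (f (star (antipode a)))^*.

Definition star_subalgebra_of_forms (S : set (halg H -> R[i])) : Prop :=
  [/\ S (fun=> 0),
      forall (c : R[i]) f g, S f -> S g -> S (fun a => c * f a + g a),
      forall f g, S f -> S g -> S (convolution f g) &
      forall f, S f -> S (form_star f)].

Definition cstar_dual (B : cstarAlgType R) : set (B -> R[i]) :=
  [set phi | scalar phi /\
     exists M : R, forall b, Normc.normc (phi b) <= M * cnorm b].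

Definition coefficients (B : cstarAlgType R) (pi : H -> B) :
    set (halg H -> R[i]) :=
  [set (fun a => phi (pi (hincl a))) | phi in @cstar_dual B].

Definition inner_faithful (B : cstarAlgType R) (pi : H -> B) : Prop :=
  linear_forms `<=`
  @closure {ptws halg H -> R[i]}
    (smallest star_subalgebra_of_forms (coefficients pi)).

End InnerFaithful.

Section Quaternions.
Variable R : realType.
Local Notation C := R[i].

Definition mx22 (a b c d : C) : 'M[C]_2 :=
  \matrix_(r, s) nth 0 (nth [::] [:: [:: a; b]; [:: c; d]] r) s.

Definition quat : 4.-tuple 'M[C]_2 :=
  [tuple mx22 1 0 0 1; mx22 'i 0 0 (- 'i); mx22 0 1 (-1) 0; mx22 0 'i 'i 0].

Definition hs_form (a b : 'M[C]_2) : C := 2^-1 * \tr (a *m b^t*).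

Definition line_proj (y a : 'M[C]_2) : 'M[C]_2 :=
  (hs_form a y / hs_form y y) *: y.

(* The matrix of a linear endomorphism of M_2(C), acting on column vectors, in
   the basis of matrix units; [lin_mx] is for row vectors and reverses
   composition, hence the transposition. *)
Definition endo_mx (f : 'M[C]_2 -> 'M[C]_2) : 'M[C]_4 := (lin_mx f)^T.

Definition line_proj_mx (y : 'M[C]_2) : 'M[C]_4 := endo_mx (line_proj y).

Lemma hs_form_linear y : scalar (hs_form^~ y).
Proof.
move=> c a b; rewrite /hs_form mulmxDl -scalemxAl mxtraceD mxtraceZ.
by rewrite mulrDr mulrCA.
Qed.

Lemma hs_formE y : hs_form y y = 2^-1 * \sum_i \sum_j `|y i j| ^+ 2.
Proof.
rewrite /hs_form; congr (_ * _); apply: eq_bigr => i _.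
by rewrite mxE; apply: eq_bigr => j _; rewrite !mxE normCK.
Qed.

Lemma hs_form_neq0 y : y != 0 -> hs_form y y != 0.
Proof.
apply: contraNN; rewrite hs_formE mulf_eq0 invr_eq0 pnatr_eq0/=.
rewrite psumr_eq0 => [/allP y0|i _]; last by apply: sumr_ge0 => j _; rewrite exprn_ge0.
apply/eqP/matrixP => i j; rewrite mxE.
have /= := y0 i (mem_index_enum _).
rewrite psumr_eq0 => [/allP/(_ j (mem_index_enum _))|k _]; last by rewrite exprn_ge0.
by rewrite /= expf_eq0/= normr_eq0 => /eqP.
Qed.

Lemma line_projP y a : y != 0 ->
  (exists c, line_proj y a = c *: y) /\ hs_form (a - line_proj y a) y = 0.
Proof.
move=> y0; split; first by exists (hs_form a y / hs_form y y).
have := hs_form_linear y (- (hs_form a y / hs_form y y)) y a.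
rewrite [_ *: y + a]addrC scaleNr => ->.
by rewrite mulNr divfK ?addNr// hs_form_neq0.
Qed.

Lemma endo_mxP (f : {linear 'M[C]_2 -> 'M[C]_2}) (a : 'M[C]_2) :
  endo_mx f *m ((mxvec a)^T : 'cV_4) = (mxvec (f a))^T.
Proof.
suff : (lin_mx f)^T *m (mxvec a)^T = (mxvec (f a))^T by [].
by rewrite -trmx_mul mul_vec_lin.
Qed.

End Quaternions.

(* Main.v *)
Require Import Defs.
From HB Require Import structures.
From mathcomp Require Import all_boot all_order all_algebra.
From mathcomp Require Import sesquilinear spectral.
From mathcomp Require Import all_classical all_reals all_analysis.
From mathcomp.real_closed Require Import complex.
From mathcomp Require Import ring.
Set Implicit Arguments.
Unset Strict Implicit.
Unset Printing Implicit Defensive.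
Import Order.TTheory GRing.Theory Num.Theory.
Import numFieldNormedType.Exports.
Local Open Scope ring_scope.
Local Open Scope sesquilinear_scope.
Import ComplexField.

(** The representation is injective on the dense Hopf *-subalgebra, so its
    coefficients already separate the points of that algebra, and a space of
    linear forms which separates points is weakly dense.

    For injectivity, write [q_0, .., q_3] for the quaternions 1, i, j, k and let
    [x] be the Fourier transform of [u] over the Klein group {1,i,j,k}/{+1,-1}.
    The magic relations say that [x] is a twisted SO(3) matrix: its entries
    commute up to sign, with the same signs as the operators
    [T_ab : z |-> q_a z q_b^*]. Hence the elements [x_ab (x) T_ab] commute and
    form a special orthogonal matrix over a commutative ring, while the
    representation sends [x_ab] to the function [x |-> R_ab(x) T_ab], where [R(x)]
    is the rotation defined by the unit quaternion [x]. As the [T_ab] are linearly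
    independent, everything reduces to this: a polynomial vanishing on the
    rotation matrices vanishes on every special orthogonal matrix [y] over a
    commutative ring. By the Euler-Rodrigues formula there are four multiples
    [N_k y] of [y], with [N_0 + .. + N_3 = 1], whose entries are the quadratic
    forms [R_ab] evaluated at four ring elements; so [N_k ^ n] kills the value of
    the polynomial for each [k], hence that value is 0. *)

(** * Rotations and special orthogonal matrices *)

Local Notation o0 := (@Ordinal 4 0 isT).
Local Notation o1 := (@Ordinal 4 1 isT).
Local Notation o2 := (@Ordinal 4 2 isT).
Local Notation o3 := (@Ordinal 4 3 isT).

Lemma ord4P (P : 'I_4 -> Prop) : P o0 -> P o1 -> P o2 -> P o3 -> forall a, P a.
Proof.
move=> P0 P1 P2 P3 [[|[|[|[|m]]]] lt_m4] //.
- by rewrite (_ : Ordinal _ = o0) //; apply/val_inj.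
- by rewrite (_ : Ordinal _ = o1) //; apply/val_inj.
- by rewrite (_ : Ordinal _ = o2) //; apply/val_inj.
- by rewrite (_ : Ordinal _ = o3) //; apply/val_inj.
Qed.

Lemma sum_ord4 (V : nmodType) (F : 'I_4 -> V) :
  \sum_a F a = F o0 + F o1 + F o2 + F o3.
Proof.
rewrite !big_ord_recr big_ord0 /= add0r.
by congr (_ + _ + _ + _); congr F; apply/val_inj.
Qed.

(** The cyclic order 1, 2, 3, 1 of the imaginary units, with 0 fixed: [q_a] times its successor is
    the unit that comes next. *)
Definition next3 (a : 'I_4) : 'I_4 :=
  match val a with 0 => o0 | 1 => o2 | 2 => o3 | _ => o1 end.

Section Rotation.
Variable D : comNzRingType.
Implicit Type w : 'I_4 -> D.

(* The coefficient of [q_b] in [x^* q_a x], where [x] is the quaternion with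
   coordinates [w]; the indices a, b = 0 correspond to [q_0 = 1], whence the
   norm of [x] at (0, 0). *)
Definition rotation w (a b : 'I_4) : D :=
  let t := w o0 in let x := w o1 in let y := w o2 in let z := w o3 in
  match val a, val b with
  | 0, 0 => t ^+ 2 + x ^+ 2 + y ^+ 2 + z ^+ 2
  | 0, _ | _, 0 => 0
  | 1, 1 => t ^+ 2 + x ^+ 2 - y ^+ 2 - z ^+ 2
  | 1, 2 => 2 * (x * y - t * z)
  | 1, _ => 2 * (x * z + t * y)
  | 2, 1 => 2 * (x * y + t * z)
  | 2, 2 => t ^+ 2 - x ^+ 2 + y ^+ 2 - z ^+ 2
  | 2, _ => 2 * (y * z - t * x)
  | _, 1 => 2 * (x * z - t * y)
  | _, 2 => 2 * (y * z + t * x)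
  | _, _ => t ^+ 2 - x ^+ 2 - y ^+ 2 + z ^+ 2
  end.

(* A matrix of SO(3) with rows and columns 1, 2, 3, bordered by a row and a
   column 0 of the identity; the last condition says that [y] is equal to its
   cofactor matrix. *)
Definition special_orthogonal (y : 'I_4 -> 'I_4 -> D) : Prop :=
  [/\ y o0 o0 = 1,
      forall a, a != o0 -> y a o0 = 0 /\ y o0 a = 0,
      forall a b, \sum_c y a c * y b c = (a == b)%:R /\
                  \sum_c y c a * y c b = (a == b)%:R &
      forall a b, a != o0 -> b != o0 ->
        y (next3 (next3 a)) (next3 (next3 b)) =
        y a b * y (next3 a) (next3 b) - y (next3 a) b * y a (next3 b)].

(* Euler-Rodrigues without square roots: [w] is the quaternion of the rotation [y]
   multiplied by its real part. Each of the ten identities is an integral linear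
   combination of the relations of SO(3), displayed in its proof. *)
Lemma rotation_quadruple (h : D) (y : 'I_4 -> 'I_4 -> D) :
  4 * h = 1 -> special_orthogonal y ->
  exists w, forall a b,
    rotation w a b = h * (1 + y o1 o1 + y o2 o2 + y o3 o3) * y a b.
Proof.
move=> h4 [y00 y0 orth minor].
have /= m33 := minor o1 o1 isT isT; have /= m31 := minor o1 o2 isT isT.
have /= m32 := minor o1 o3 isT isT; have /= m13 := minor o2 o1 isT isT.
have /= m11 := minor o2 o2 isT isT; have /= m12 := minor o2 o3 isT isT.
have /= m23 := minor o3 o1 isT isT; have /= m21 := minor o3 o2 isT isT.
have /= m22 := minor o3 o3 isT isT.
rewrite /next3 /= in m33 m31 m32 m13 m11 m12 m23 m21 m22.
have [y10 y01] := y0 o1 isT; have [y20 y02] := y0 o2 isT.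
have [y30 y03] := y0 o3 isT.
have := orth o1 o1; have := orth o2 o2; have := orth o3 o3.
have := orth o1 o2; have := orth o1 o3; have := orth o2 o3.
rewrite !sum_ord4 !y10 !y20 !y30 !y01 !y02 !y03 !mulr0 !add0r /=.
move=> [r23 c23] [r13 c13] [r12 c12] [r33 c33] [r22 c22] [r11 c11].
exists (fun a => h * match val a with
  | 0 => 1 + y o1 o1 + y o2 o2 + y o3 o3
  | 1 => y o3 o2 - y o2 o3
  | 2 => y o1 o3 - y o3 o1
  | _ => y o2 o1 - y o1 o2 end).
(* Multiplying [r] by [4 * h], which is 1, gives both sides two factors [h]; [ring] can then treat
   [h] as a free variable, [e] being a combination of the relations. *)
have cert (l r e : D) : e = 0 -> l = (4 * h) * r + h ^+ 2 * e -> l = r.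
  by move=> ->; rewrite h4 mul1r mulr0 addr0.
have rel (l r : D) : l = r -> l - r = 0 by move=> ->; rewrite subrr.
move: m33 m31 m32 m13 m11 m12 m23 m21 m22 => /rel m33 /rel m31 /rel m32 /rel m13
  /rel m11 /rel m12 /rel m23 /rel m21 /rel m22.
move: r33 c33 r22 c22 r11 c11 => /rel r33 /rel c33 /rel r22 /rel c22 /rel r11
  /rel c11.
elim/ord4P; elim/ord4P; rewrite /rotation /=
  ?y00 ?y10 ?y20 ?y30 ?y01 ?y02 ?y03 ?mulr0 //.
- apply: (cert _ _ (- 2 * (y o3 o3 - (y o1 o1 * y o2 o2 - y o2 o1 * y o1 o2)) +
      - 2 * (y o1 o1 - (y o2 o2 * y o3 o3 - y o3 o2 * y o2 o3)) +
      - 2 * (y o2 o2 - (y o3 o3 * y o1 o1 - y o1 o3 * y o3 o1)) +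
      (y o1 o1 * y o1 o1 + y o1 o2 * y o1 o2 + y o1 o3 * y o1 o3 - 1) +
      (y o2 o1 * y o2 o1 + y o2 o2 * y o2 o2 + y o2 o3 * y o2 o3 - 1) +
      (y o3 o1 * y o3 o1 + y o3 o2 * y o3 o2 + y o3 o3 * y o3 o3 - 1)));
  last by ring.
  by rewrite m33 m11 m22 r11 r22 r33 !(mulr0, oppr0, addr0).
- apply: (cert _ _ (2 * (y o3 o3 - (y o1 o1 * y o2 o2 - y o2 o1 * y o1 o2)) +
      - 2 * (y o1 o1 - (y o2 o2 * y o3 o3 - y o3 o2 * y o2 o3)) +
      2 * (y o2 o2 - (y o3 o3 * y o1 o1 - y o1 o3 * y o3 o1)) +
      - (y o1 o1 * y o1 o1 + y o1 o2 * y o1 o2 + y o1 o3 * y o1 o3 - 1) +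
      - 2 * (y o1 o1 * y o1 o1 + y o2 o1 * y o2 o1 + y o3 o1 * y o3 o1 - 1) +
      (y o2 o1 * y o2 o1 + y o2 o2 * y o2 o2 + y o2 o3 * y o2 o3 - 1) +
      (y o3 o1 * y o3 o1 + y o3 o2 * y o3 o2 + y o3 o3 * y o3 o3 - 1)));
  last by ring.
  by rewrite m33 m11 m22 r11 c11 r22 r33 !(mulr0, oppr0, addr0).
- apply: (cert _ _ (- 2 * (y o1 o2 - (y o2 o3 * y o3 o1 - y o3 o3 * y o2 o1)) +
      - 2 * (y o2 o1 - (y o3 o2 * y o1 o3 - y o1 o2 * y o3 o3)) +
      - 2 * (y o1 o1 * y o2 o1 + y o1 o2 * y o2 o2 + y o1 o3 * y o2 o3) +
      - 2 * (y o1 o1 * y o1 o2 + y o2 o1 * y o2 o2 + y o3 o1 * y o3 o2)));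
  last by ring.
  by rewrite m12 m21 r12 c12 !(mulr0, oppr0, addr0).
- apply: (cert _ _ (- 2 * (y o3 o1 - (y o1 o2 * y o2 o3 - y o2 o2 * y o1 o3)) +
      - 2 * (y o1 o3 - (y o2 o1 * y o3 o2 - y o3 o1 * y o2 o2)) +
      - 2 * (y o1 o1 * y o3 o1 + y o1 o2 * y o3 o2 + y o1 o3 * y o3 o3) +
      - 2 * (y o1 o1 * y o1 o3 + y o2 o1 * y o2 o3 + y o3 o1 * y o3 o3)));
  last by ring.
  by rewrite m31 m13 r13 c13 !(mulr0, oppr0, addr0).
- apply: (cert _ _ (- 2 * (y o1 o2 - (y o2 o3 * y o3 o1 - y o3 o3 * y o2 o1)) +
      - 2 * (y o2 o1 - (y o3 o2 * y o1 o3 - y o1 o2 * y o3 o3)) +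
      - 2 * (y o1 o1 * y o2 o1 + y o1 o2 * y o2 o2 + y o1 o3 * y o2 o3) +
      - 2 * (y o1 o1 * y o1 o2 + y o2 o1 * y o2 o2 + y o3 o1 * y o3 o2)));
  last by ring.
  by rewrite m12 m21 r12 c12 !(mulr0, oppr0, addr0).
- apply: (cert _ _ (2 * (y o3 o3 - (y o1 o1 * y o2 o2 - y o2 o1 * y o1 o2)) +
      2 * (y o1 o1 - (y o2 o2 * y o3 o3 - y o3 o2 * y o2 o3)) +
      - 2 * (y o2 o2 - (y o3 o3 * y o1 o1 - y o1 o3 * y o3 o1)) +
      (y o1 o1 * y o1 o1 + y o1 o2 * y o1 o2 + y o1 o3 * y o1 o3 - 1) +
      - (y o2 o1 * y o2 o1 + y o2 o2 * y o2 o2 + y o2 o3 * y o2 o3 - 1) +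
      - 2 * (y o1 o2 * y o1 o2 + y o2 o2 * y o2 o2 + y o3 o2 * y o3 o2 - 1) +
      (y o3 o1 * y o3 o1 + y o3 o2 * y o3 o2 + y o3 o3 * y o3 o3 - 1)));
  last by ring.
  by rewrite m33 m11 m22 r11 r22 c22 r33 !(mulr0, oppr0, addr0).
- apply: (cert _ _ (- 2 * (y o3 o2 - (y o1 o3 * y o2 o1 - y o2 o3 * y o1 o1)) +
      - 2 * (y o2 o3 - (y o3 o1 * y o1 o2 - y o1 o1 * y o3 o2)) +
      - 2 * (y o2 o1 * y o3 o1 + y o2 o2 * y o3 o2 + y o2 o3 * y o3 o3) +
      - 2 * (y o1 o2 * y o1 o3 + y o2 o2 * y o2 o3 + y o3 o2 * y o3 o3)));
  last by ring.
  by rewrite m32 m23 r23 c23 !(mulr0, oppr0, addr0).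
- apply: (cert _ _ (- 2 * (y o3 o1 - (y o1 o2 * y o2 o3 - y o2 o2 * y o1 o3)) +
      - 2 * (y o1 o3 - (y o2 o1 * y o3 o2 - y o3 o1 * y o2 o2)) +
      - 2 * (y o1 o1 * y o3 o1 + y o1 o2 * y o3 o2 + y o1 o3 * y o3 o3) +
      - 2 * (y o1 o1 * y o1 o3 + y o2 o1 * y o2 o3 + y o3 o1 * y o3 o3)));
  last by ring.
  by rewrite m31 m13 r13 c13 !(mulr0, oppr0, addr0).
- apply: (cert _ _ (- 2 * (y o3 o2 - (y o1 o3 * y o2 o1 - y o2 o3 * y o1 o1)) +
      - 2 * (y o2 o3 - (y o3 o1 * y o1 o2 - y o1 o1 * y o3 o2)) +
      - 2 * (y o2 o1 * y o3 o1 + y o2 o2 * y o3 o2 + y o2 o3 * y o3 o3) +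
      - 2 * (y o1 o2 * y o1 o3 + y o2 o2 * y o2 o3 + y o3 o2 * y o3 o3)));
  last by ring.
  by rewrite m32 m23 r23 c23 !(mulr0, oppr0, addr0).
- apply: (cert _ _ (- 2 * (y o3 o3 - (y o1 o1 * y o2 o2 - y o2 o1 * y o1 o2)) +
      2 * (y o1 o1 - (y o2 o2 * y o3 o3 - y o3 o2 * y o2 o3)) +
      2 * (y o2 o2 - (y o3 o3 * y o1 o1 - y o1 o3 * y o3 o1)) +
      - (y o1 o1 * y o1 o1 + y o1 o2 * y o1 o2 + y o1 o3 * y o1 o3 - 1) +
      2 * (y o1 o1 * y o1 o1 + y o2 o1 * y o2 o1 + y o3 o1 * y o3 o1 - 1) +
      - (y o2 o1 * y o2 o1 + y o2 o2 * y o2 o2 + y o2 o3 * y o2 o3 - 1) +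
      2 * (y o1 o2 * y o1 o2 + y o2 o2 * y o2 o2 + y o3 o2 * y o3 o2 - 1) +
      - 3 * (y o3 o1 * y o3 o1 + y o3 o2 * y o3 o2 + y o3 o3 * y o3 o3 - 1)));
  last by ring.
  by rewrite m33 m11 m22 r11 c11 r22 c22 r33 !(mulr0, oppr0, addr0).
Qed.
End Rotation.

(* Whether [q_a q_r = - q_r q_a]. *)
Definition anticomm (a r : 'I_4) : bool := [&& a != o0, r != o0 & a != r].

Section RotationTheory.
Variable D : comNzRingType.
Implicit Type w : 'I_4 -> D.

(** The coordinates of the quaternion [q_k x], where [x] has coordinates [w]. *)
Definition quat_lmul (k : 'I_4) w (a : 'I_4) : D :=
  match val k, val a with
  | 0, _ => w a
  | 1, 0 => - w o1 | 1, 1 => w o0 | 1, 2 => - w o3 | 1, _ => w o2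
  | 2, 0 => - w o2 | 2, 1 => w o3 | 2, 2 => w o0 | 2, _ => - w o1
  | _, 0 => - w o3 | _, 1 => - w o2 | _, 2 => w o1 | _, _ => w o0
  end.

(** For [x' = q_k x] one has [x'^* q_a x' = x^* (q_k^* q_a q_k) x], and conjugation by [q_k]
    multiplies [q_a] by a sign. *)
Lemma rotation_lmul k w a b :
  rotation (quat_lmul k w) a b = (-1) ^+ anticomm k a * rotation w a b.
Proof.
by elim/ord4P: k; elim/ord4P: a; elim/ord4P: b;
  rewrite /rotation /quat_lmul /=; ring.
Qed.

(** The signs form a diagonal rotation: among the rows 1, 2, 3 either none or exactly two are
    negated. *)
Lemma special_orthogonal_sign k (y : 'I_4 -> 'I_4 -> D) :
  special_orthogonal y ->
  special_orthogonal (fun a b => (-1) ^+ anticomm k a * y a b).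
Proof.
move=> [y00 y0 orth minor]; split.
- by rewrite y00 /anticomm andbF mul1r.
- by move=> a /y0[-> ->]; rewrite !mulr0.
- move=> a b; have [rab cab] := orth a b; split.
    under eq_bigr do rewrite mulrACA; rewrite -mulr_sumr rab.
    case: eqP => [->|_]; rewrite ?mulr0 //.
    by rewrite mulr1 -expr2 sqrr_sign.
  by rewrite -cab; apply: eq_bigr => c _; rewrite mulrACA -expr2 sqrr_sign mul1r.
- move=> a b a0 b0; rewrite minor //.
  have -> : (-1) ^+ anticomm k (next3 (next3 a)) =
      (-1) ^+ anticomm k a * (-1) ^+ anticomm k (next3 a) :> D.
    rewrite -signr_addb; congr (_ ^+ nat_of_bool _).
    by move: a0; elim/ord4P: k; elim/ord4P: a.
  ring.
Qed.

(** Euler-Rodrigues is applied to [y] composed with conjugation by [q_k], which is then undone by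
    multiplying the quaternion by [q_k]. If [y] is the rotation of a unit quaternion, the scalar
    factor is the square of its [k]-th coordinate. *)
Lemma rotation_quadruple_sign (h : D) (y : 'I_4 -> 'I_4 -> D) k :
  4 * h = 1 -> special_orthogonal y ->
  exists w, forall a b,
    rotation w a b = h * (\sum_c (-1) ^+ anticomm k c * y c c) * y a b.
Proof.
move=> h4 yso; have [w wE] := rotation_quadruple h4 (special_orthogonal_sign k yso).
exists (quat_lmul k w) => a b; rewrite rotation_lmul wE sum_ord4.
case: yso => y00 _ _ _; rewrite y00 /anticomm /= andbF mul1r.
by case: (_ && _); rewrite ?expr0 ?expr1; ring.
Qed.

Lemma rotation_map (E : comNzRingType) (f : {rmorphism D -> E}) w a b :
  f (rotation w a b) = rotation (f \o w) a b.
Proof.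
by elim/ord4P: a; elim/ord4P: b; rewrite /rotation /= ?rmorph0 //
  !(rmorphB, rmorphD, rmorphM, rmorphXn, rmorph_nat).
Qed.

Lemma eq_rotation w w' : w =1 w' -> rotation w =2 rotation w'.
Proof. by move=> ww' a b; rewrite /rotation !ww'. Qed.

(** A nontrivial character of the Klein group takes each sign twice. *)
Lemma sum_anticomm k : \sum_a (-1) ^+ anticomm a k = (4 * (k == o0)%:R : D).
Proof. by elim/ord4P: k; rewrite sum_ord4 /=; ring. Qed.

(** Every term of the binomial expansion contains [a ^+ m] or [b ^+ n]. *)
Lemma mulr_expD_eq0 (a b c : D) m n :
  a ^+ m * c = 0 -> b ^+ n * c = 0 -> (a + b) ^+ (m + n) * c = 0.
Proof.
move=> am bn; rewrite exprDn mulr_suml big1 // => i _; rewrite mulrnAl.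
have [ni|ni] := leqP n i.
  by rewrite -(subnK ni) exprD -!mulrA bn !mulr0 mul0rn.
have mi : (m <= m + n - i)%N by rewrite -addnBA ?leq_addr // ltnW.
by rewrite -(subnK mi) exprD -!mulrA [_ * c]mulrC [a ^+ m * _]mulrA am mul0r mulr0 mul0rn.
Qed.

End RotationTheory.

(** * Polynomials in four variables *)

Section Poly4Eval.
Variables (C D : comNzRingType) (phi : {rmorphism C -> D}).

Let comm_any (E : nzRingType) (f : {rmorphism E -> D}) u : commr_rmorph f u.
Proof. by move=> x; exact: mulrC. Qed.

Definition horner_rmorphism (E : nzRingType) (f : {rmorphism E -> D}) (u : D) :
  {rmorphism {poly E} -> D} :=
  horner_morph (comm_any f u).

Lemma horner_rmorphismX (E : nzRingType) (f : {rmorphism E -> D}) u :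
  horner_rmorphism f u 'X = u.
Proof. exact: horner_morphX. Qed.

Lemma horner_rmorphismC (E : nzRingType) (f : {rmorphism E -> D}) u c :
  horner_rmorphism f u c%:P = f c.
Proof. exact: horner_morphC. Qed.

(** Four variables are encoded by iterated univariate polynomials, index 0 being innermost, so that
    vanishing can be settled one variable at a time. *)
Definition poly4_eval (w : 'I_4 -> D) :
  {rmorphism {poly {poly {poly {poly C}}}} -> D} :=
  horner_rmorphism (horner_rmorphism
    (horner_rmorphism (horner_rmorphism phi (w o0)) (w o1)) (w o2)) (w o3).

End Poly4Eval.

Definition poly4_var (C : comNzRingType) (a : 'I_4) : {poly {poly {poly {poly C}}}} :=
  match val a with
  | 0 => 'X%:P%:P%:P | 1 => 'X%:P%:P | 2 => 'X%:P | _ => 'X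
  end.
Definition poly4_const (C : comNzRingType) (c : C) : {poly {poly {poly {poly C}}}} :=
  c%:P%:P%:P%:P.

Section Poly4EvalTheory.
Variables (C D : comNzRingType) (phi : {rmorphism C -> D}) (w : 'I_4 -> D).
Lemma poly4_eval_var a : poly4_eval phi w (poly4_var C a) = w a.
Proof.
by elim/ord4P: a; rewrite /poly4_eval /poly4_var ?horner_rmorphismX //
  !horner_rmorphismC horner_rmorphismX.
Qed.
Lemma poly4_eval_const c : poly4_eval phi w (poly4_const c) = phi c.
Proof. by rewrite /poly4_eval /poly4_const !horner_rmorphismC. Qed.
End Poly4EvalTheory.

(** The induction step on the number of variables. The morphisms [f i] jointly detect zero among the
    coefficients, so every positive integer is a root of [p]; in characteristic 0 these are
    infinitely many. *)
Lemma poly_eq0_points (E : idomainType) (I : Type) (C : comNzRingType)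
    (f : I -> {rmorphism E -> C}) (p : {poly E}) :
  (forall n, (n.+1%:R : E) != 0) ->
  (forall e, (forall i, f i e = 0) -> e = 0) ->
  (forall i n, horner_rmorphism (f i) n.+1%:R p = 0) -> p = 0.
Proof.
move=> char0 sep fp; have rootp n : root p n.+1%:R.
  apply/eqP; apply: sep => i; rewrite -(fp i n) /horner_rmorphism /= /horner_morph.
  rewrite -horner_map; congr (_.[_]); exact: rmorph_nat.
apply/eqP; apply: contraT => p0.
(* A nonzero polynomial has strictly fewer than [size p] distinct roots. *)
pose s := [seq (n.+1%:R : E) | n <- iota 0 (size p)].
have := @max_poly_roots _ p s p0; rewrite size_map size_iota ltnn; apply.
  by apply/allP => _ /mapP[n _ ->].
rewrite map_inj_uniq ?iota_uniq // => m n.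
wlog lemn : m n / (m <= n)%N.
  by move=> W; case/orP: (leq_total m n) => [/W//|/W + e]; move=> /(_ (esym e)).
move/eqP; rewrite eq_sym -subr_eq0 -natrB ?ltnS // subSS.
case: (posnP (n - m)) => [/eqP|/prednK <-]; last by rewrite (negbTE (char0 _)).
by rewrite subn_eq0 => nm _; apply/eqP; rewrite eqn_leq lemn.
Qed.

(** The evaluations of the inner variables at positive integers are the detecting family for the
    next variable outwards. *)
Lemma poly4_eq0 (C : numFieldType) (p : {poly {poly {poly {poly C}}}}) :
  (forall q : 'I_4 -> nat, poly4_eval idfun (fun a => (q a).+1%:R) p = 0) -> p = 0.
Proof.
move=> p0.
have c0 n : (n.+1%:R : C) != 0 by rewrite pnatr_eq0.
have pc (E : idomainType) : (forall n, (n.+1%:R : E) != 0) ->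
    (forall n, (n.+1%:R : {poly E}) != 0).
  by move=> e0 n; rewrite -polyC_natr polyC_eq0.
have c1 := pc _ c0; have c2 := pc _ c1; have c3 := pc _ c2.
pose h1 n0 := horner_rmorphism (idfun : {rmorphism C -> C}) (n0 : nat).+1%:R.
pose h2 n := horner_rmorphism (h1 n.2) (n.1 : nat).+1%:R.
pose h3 n := horner_rmorphism (h2 n.2) (n.1 : nat).+1%:R.
have s1 e : (forall i, h1 i e = 0) -> e = 0.
  by move=> H; apply: (@poly_eq0_points C unit C (fun=> idfun)) => [//|e' /(_ tt)//|_ n];
    exact: H.
have s2 e : (forall i, h2 i e = 0) -> e = 0.
  by move=> H; apply: (poly_eq0_points c1 s1) => i n; exact: (H (n, i)).
have s3 e : (forall i, h3 i e = 0) -> e = 0.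
  by move=> H; apply: (poly_eq0_points c2 s2) => i n; exact: (H (n, i)).
apply: (poly_eq0_points c3 s3) => -[n2 [n1 n0]] n3.
exact: (p0 (fun a => nth 0%N [:: n0; n1; n2; n3] a)).
Qed.

(** Monomials are words whose order is kept, because the same words are also evaluated at
    noncommuting elements. *)
Definition word_val (D : pzRingType) (y : 'I_4 -> 'I_4 -> D)
    (s : seq ('I_4 * 'I_4)) : D :=
  \prod_(p <- s) y p.1 p.2.

(* [N k ^+ n] makes the polynomial homogeneous in the quaternion coordinates,
   and a polynomial which is zero at all points with positive integral coordinates
   is zero. *)
Theorem word_vanish (C : numFieldType) (D : comNzRingType)
    (phi : {rmorphism C -> D}) (y : 'I_4 -> 'I_4 -> D)
    (r : seq (C * seq ('I_4 * 'I_4))) :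
  special_orthogonal y ->
  (forall q : 'I_4 -> nat, let R := rotation (fun a => (q a).+1%:R : C) in
     \sum_(z <- r) z.1 * word_val (fun a b => R a b / R o0 o0) z.2 = 0) ->
  \sum_(z <- r) phi z.1 * word_val y z.2 = 0.
Proof.
move=> yso r0; set F := (X in X = 0).
pose n := \max_(z <- r) size z.2.
have size_n z : z \in r -> (size z.2 <= n)%N by move=> zr; apply: leq_bigmax_seq.
(* Each word is padded by powers of the norm form to the common length [n], which makes [G]
   homogeneous of degree [2 * n] in the coordinates. *)
pose G := \sum_(z <- r) poly4_const z.1 *
  (rotation (poly4_var C) o0 o0 ^+ (n - size z.2) *
   word_val (rotation (poly4_var C)) z.2).
have evG (E : comNzRingType) (f : {rmorphism C -> E}) w : poly4_eval f w G =
    \sum_(z <- r) f z.1 *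
      (rotation w o0 o0 ^+ (n - size z.2) * word_val (rotation w) z.2).
  rewrite rmorph_sum; apply: eq_bigr => z _.
  have ew a b : poly4_eval f w (rotation (poly4_var C) a b) = rotation w a b.
    by rewrite rotation_map; apply: eq_rotation => c; rewrite /= poly4_eval_var.
  rewrite !rmorphM rmorphXn poly4_eval_const ew; congr (_ * (_ * _)).
  by rewrite rmorph_prod; apply: eq_bigr => p _; rewrite ew.
have homog (E : comNzRingType) (y' w : 'I_4 -> 'I_4 -> E) (N : E) s :
    (size s <= n)%N -> (forall a b, w a b = N * y' a b) ->
    N ^+ (n - size s) * word_val w s = N ^+ n * word_val y' s.
  move=> sn wE; rewrite -[in RHS](subnK sn) exprD -mulrA; congr (_ * _).
  rewrite /word_val; elim: s {sn} => [|p s IH]; first by rewrite !big_nil mulr1.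
  by rewrite !big_cons IH wE exprS mulrACA.
have G0 : G = 0.
  apply: poly4_eq0 => q; rewrite evG.
  set R := rotation _; have N0 : R o0 o0 != 0.
    rewrite /R /rotation /= -!natrX -!natrD pnatr_eq0 -!mulnn.
    by rewrite !mulSn !addSn.
  have := r0 q; rewrite -/R => /(congr1 (fun v => R o0 o0 ^+ n * v)).
  rewrite mulr0 mulr_sumr => e; rewrite -[RHS]e.
  apply: eq_big_seq => z zr; rewrite [RHS]mulrCA.
  congr (_ * _); apply: homog; first exact: size_n.
  by move=> a b; rewrite mulrCA divff ?mulr1.
have h4 : 4 * phi 4^-1 = 1.
  by rewrite -(rmorph_nat phi) -rmorphM divff ?rmorph1 // pnatr_eq0.
pose N k := phi 4^-1 * \sum_c (-1) ^+ anticomm k c * y c c.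
(* This product is the value of [G], which is 0, at the quadruple attached to [k]. *)
have NF k : N k ^+ n * F = 0.
  have [w wE] := rotation_quadruple_sign k h4 yso.
  rewrite -[RHS](rmorph0 (poly4_eval phi w)) -G0 evG mulr_sumr.
  apply: eq_big_seq => z zr; rewrite mulrCA; congr (_ * _); symmetry.
  case: (yso) => y00 _ _ _.
  have NE : rotation w o0 o0 = N k by rewrite wE y00 mulr1.
  by rewrite NE; apply: homog; [exact: size_n|move=> a b; rewrite wE].
(* Summing the signs over [k] leaves only the diagonal entry at (0, 0), which is 1. *)
have N1 : N o0 + N o1 + N o2 + N o3 = 1.
  rewrite -(@sum_ord4 _ N) -mulr_sumr exchange_big /=.
  under eq_bigr do rewrite -mulr_suml sum_anticomm.
  rewrite (bigD1 o0) //= big1 => [|c /negbTE ->]; last by rewrite mulr0 mul0r.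
  by case: yso => -> _ _ _; rewrite !mulr1 addr0 mulrC.
have := mulr_expD_eq0 (mulr_expD_eq0 (mulr_expD_eq0 (NF o0) (NF o1)) (NF o2)) (NF o3).
by rewrite N1 expr1n mul1r.
Qed.

(** * Commuting families *)

(* The bicommutant of a commuting family is a commutative subring. *)
Section Bicommutant.
Variables (B : nzRingType) (I : Type) (y : I -> B).

Definition commutant : B -> Prop := fun c => forall i, GRing.comm c (y i).

Definition bicommutant : {pred B} :=
  fun b => `[< forall c, commutant c -> GRing.comm b c >].

Lemma bicommutantP b :
  reflect (forall c, commutant c -> GRing.comm b c) (b \in bicommutant).
Proof. exact: asboolP. Qed.

Lemma bicommutant_subring : subring_closed bicommutant.
Proof.
split; first by apply/bicommutantP => c _; exact: commr_sym (commr1 _).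
  move=> a b /bicommutantP ac /bicommutantP bc; apply/bicommutantP => c cc.
  by apply/commr_sym/commrB; apply: commr_sym; [exact: ac | exact: bc].
move=> a b /bicommutantP ac /bicommutantP bc; apply/bicommutantP => c cc.
by apply/commr_sym/commrM; apply: commr_sym; [exact: ac | exact: bc].
Qed.

HB.instance Definition _ :=
  GRing.isSubringClosed.Build B bicommutant bicommutant_subring.

Hypothesis y_comm : forall i j, GRing.comm (y i) (y j).

(** The proof of commutation is a parameter of the type, so that a commutative ring structure can be
    attached to it. *)
Definition commuting_subring of (forall i j, GRing.comm (y i) (y j)) :=
  {b | b \in bicommutant}.
Local Notation T := (commuting_subring y_comm).

HB.instance Definition _ := SubType.copy T {b | b \in bicommutant}.
HB.instance Definition _ := [Choice of T by <:].
HB.instance Definition _ := [SubChoice_isSubNzRing of T by <:].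

(** The [y i] lie in their own commutant, so elements of the bicommutant commute with them. Such
    elements thus lie in the commutant too, and commute with each other. *)
Lemma commuting_subring_mulC : commutative (@GRing.mul T).
Proof.
move=> a b; apply: val_inj; rewrite !rmorphM.
apply: (bicommutantP _ (valP a)) => i.
by apply: (bicommutantP _ (valP b)) => j; exact: y_comm.
Qed.

HB.instance Definition _ :=
  GRing.PzRing_hasCommutativeMul.Build T commuting_subring_mulC.

Lemma mem_bicommutant i : y i \in bicommutant.
Proof. by apply/bicommutantP => c cc; exact/commr_sym/cc. Qed.

End Bicommutant.

Lemma commuting_subring_exists (B : nzRingType) (I : Type) (y : I -> B) :
  (forall i j, GRing.comm (y i) (y j)) ->
  exists (D : comNzRingType) (f : {rmorphism D -> B}),
    injective f /\ forall i, exists d, f d = y i.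
Proof.
move=> y_comm; exists (commuting_subring y_comm), val; split; first exact: val_inj.
by move=> i; exists (Sub (y i) (mem_bicommutant y i)); exact: SubK.
Qed.

(** Preimages under an injective morphism are unique, so choosing them respects the ring
    operations. *)
Lemma rmorphism_lift (C D B : nzRingType) (f : {rmorphism D -> B})
    (g : {rmorphism C -> B}) : injective f -> (forall c, exists d, f d = g c) ->
  exists h : {rmorphism C -> D}, forall c, f (h c) = g c.
Proof.
move=> f_inj gf; pose h c := projT1 (cid (gf c)).
have hE c : f (h c) = g c by rewrite /h; case: cid.
have hB : zmod_morphism h by move=> a b; apply: f_inj; rewrite rmorphB !hE rmorphB.
have hM : monoid_morphism h.
  by split=> [|a b]; apply: f_inj; rewrite ?rmorph1 ?rmorphM !hE ?rmorph1 ?rmorphM.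
have @h' : {rmorphism C -> D} := HB.pack h
  (GRing.isZmodMorphism.Build _ _ h hB) (GRing.isMonoidMorphism.Build _ _ h hM).
by exists h'.
Qed.

(** * The Fourier transform of a magic matrix *)

(* [q_a q_b] is equal to [q_(klein_add a b)] up to sign. *)
Definition klein_add (a b : 'I_4) : 'I_4 :=
  match val a, val b with
  | 0, _ => b | _, 0 => a
  | 1, 1 | 2, 2 | 3, 3 => o0
  | 1, 2 | 2, 1 => o3
  | 1, _ | _, 1 => o2
  | _, _ => o1
  end.

Lemma anticommC a b : anticomm a b = anticomm b a.
Proof. by elim/ord4P: a; elim/ord4P: b. Qed.

Lemma anticommD a b r :
  anticomm (klein_add a b) r = anticomm a r (+) anticomm b r.
Proof. by elim/ord4P: a; elim/ord4P: b; elim/ord4P: r. Qed.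

Lemma klein_addC a b : klein_add a b = klein_add b a.
Proof. by elim/ord4P: a; elim/ord4P: b. Qed.

Lemma klein_addKr a b : klein_add a (klein_add a b) = b.
Proof. by elim/ord4P: a; elim/ord4P: b. Qed.

Lemma klein_add0 a : klein_add a o0 = a.
Proof. by elim/ord4P: a. Qed.

Lemma klein_addNr a : klein_add a a = o0.
Proof. by elim/ord4P: a. Qed.

Lemma klein_add_eq0 a b : (klein_add a b == o0) = (a == b).
Proof. by elim/ord4P: a; elim/ord4P: b. Qed.

(** Two distinct nonzero elements of the Klein group and their sum exhaust its nonzero elements. *)
Lemma sum_klein (V : nmodType) (F : 'I_4 -> V) a b :
  a != o0 -> b != o0 -> a != b ->
  \sum_c F c = F o0 + F (klein_add a b) + F a + F b.
Proof.
rewrite sum_ord4; elim/ord4P: a => //; elim/ord4P: b => //= _ _ _.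
- exact: (ACl (1 * 4 * 2 * 3)).
- exact: (ACl (1 * 3 * 2 * 4)).
- exact: (ACl (1 * 4 * 3 * 2)).
- exact: (ACl (1 * 3 * 4 * 2)).
- exact: (ACl (1 * 2 * 4 * 3)).
Qed.

(** Hamilton's relations in any ring; they will hold for the quaternion matrices and for the
    operators of left and right multiplication. *)
Definition quaternion_units (B : nzRingType) (L : 'I_4 -> B) : Prop :=
  [/\ L o0 = 1, forall a, a != o0 -> L a * L a = -1 &
      forall a, a != o0 -> L a * L (next3 a) = L (next3 (next3 a))].

Section QuaternionUnits.
Variables (B : nzRingType) (L : 'I_4 -> B) (Lq : quaternion_units L).

(** Substitute [L a = L (next3 a) * L (next3 (next3 a))] and use that the imaginary units have
    square -1. *)
Lemma quaternion_units_next_rev a : a != o0 ->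
  L (next3 a) * L a = - L (next3 (next3 a)).
Proof.
case: Lq => _ LL Ln a0.
have n0 : next3 a != o0 by move: a0; elim/ord4P: a.
have nnn : next3 (next3 (next3 a)) = a by clear n0; move: a0; elim/ord4P: a.
have := Ln (next3 a) n0; rewrite nnn => <-.
by rewrite mulrA LL // mulN1r.
Qed.

Lemma quaternion_unitsM a b :
  exists e : bool, L a * L b = (-1) ^+ e * L (klein_add a b).
Proof.
have [L0 LL Ln] := Lq; have Lr := quaternion_units_next_rev.
have [->|a0] := eqVneq a o0; first by exists false; rewrite L0 !mul1r.
have [->|b0] := eqVneq b o0.
  by exists false; rewrite klein_addC L0 mulr1 mul1r.
have [<-|ab] := eqVneq a b.
  by exists true; rewrite LL // klein_addNr L0 mulr1.
have := Ln a a0; have := Lr a a0; have := Ln b b0; have := Lr b b0.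
by move: a0 b0 ab; elim/ord4P: a => // _; elim/ord4P: b => // _ _;
  rewrite /next3 /= => h1 h2 h3 h4;
  ((by exists true; rewrite expr1 mulN1r) || (by exists false; rewrite mul1r)).
Qed.

Lemma quaternion_units_anticomm a b :
  L a * L b = (-1) ^+ anticomm a b * (L b * L a).
Proof.
have [L0 LL Ln] := Lq; have Lr := quaternion_units_next_rev.
have [->|a0] := eqVneq a o0; first by rewrite L0 !mul1r mulr1.
have [->|b0] := eqVneq b o0; first by rewrite anticommC L0 !mul1r mulr1.
have [<-|ab] := eqVneq a b; first by rewrite /anticomm eqxx !andbF mul1r.
have := Ln a a0; have := Lr a a0; have := Ln b b0; have := Lr b b0.
by move: a0 b0 ab; elim/ord4P: a => // _; elim/ord4P: b => // _ _;
  rewrite /next3 /= expr1 mulN1r => h1 h2 h3 h4; rewrite ?h1 ?h2 ?h3 ?h4 ?opprK.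
Qed.

End QuaternionUnits.

Section Fourier.
Variables (C : numFieldType) (A : algType C).
Implicit Types u x : 'I_4 -> 'I_4 -> A.

(* The characters of the Klein group, which is identified with its dual by the
   commutation signs of the quaternions. *)
Definition sgn4 (a r : 'I_4) : C := (-1) ^+ anticomm a r.

Lemma sgn4C a r : sgn4 a r = sgn4 r a.
Proof. by rewrite /sgn4 anticommC. Qed.

Lemma sgn4D a b r : sgn4 (klein_add a b) r = sgn4 a r * sgn4 b r.
Proof. by rewrite /sgn4 anticommD signr_addb. Qed.

Lemma sum_sgn4 a b : \sum_r sgn4 a r * sgn4 b r = 4 * (a == b)%:R.
Proof.
under eq_bigr do rewrite -sgn4D sgn4C.
by rewrite sum_anticomm klein_add_eq0.
Qed.

(** The constant is the inverse square root of 16, the order of the product of two Klein groups; it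
    makes the transform an involution. *)
Definition fourier u (a b : 'I_4) : A :=
  4^-1 *: \sum_r \sum_s (sgn4 a r * sgn4 b s) *: u r s.

Definition row_partition u : Prop :=
  (forall r s s', u r s * u r s' = (s == s')%:R *: u r s) /\
  forall r, \sum_s u r s = 1.

Definition fourier_row_mul x : Prop :=
  forall c b b', \sum_a x a b * x (klein_add a c) b' = x c (klein_add b b').

Lemma fourier_tr u a b : fourier u a b = fourier (fun r s => u s r) b a.
Proof.
rewrite /fourier exchange_big; congr (_ *: _).
by do 2![apply: eq_bigr => ? _]; rewrite mulrC.
Qed.

(** Orthogonality of characters, once for rows and once for columns; the two factors 4 cancel the
    two normalisations. *)
Lemma fourierK u r s :
  u r s = 4^-1 *: \sum_a \sum_b (sgn4 a r * sgn4 b s) *: fourier u a b.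
Proof.
have four0 : (4 : C) != 0 by rewrite pnatr_eq0.
transitivity (4^-1 *: (4^-1 *: \sum_r' \sum_s' (\sum_a \sum_b
   ((sgn4 a r * sgn4 a r') * (sgn4 b s * sgn4 b s'))) *: u r' s')).
  under eq_bigr => r' _ do under eq_bigr => s' _ do
    (under eq_bigr => a _ do rewrite -mulr_sumr; rewrite -mulr_suml).
  under eq_bigr => r' _ do under eq_bigr => s' _ do (
    under eq_bigr do rewrite sgn4C (sgn4C _ r'); rewrite sum_sgn4;
    under eq_bigr do rewrite sgn4C (sgn4C _ s'); rewrite sum_sgn4).
  rewrite (bigD1 r) //= [X in _ + X]big1 => [|r' /negbTE r'r]; last first.
    by rewrite big1 // => s' _; rewrite eq_sym r'r mulr0 mul0r scale0r.
  rewrite addr0 (bigD1 s) //= [X in _ + X]big1 => [|s' /negbTE s's]; last first.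
    by rewrite [s == _]eq_sym s's !mulr0 scale0r.
  by rewrite addr0 !eqxx !mulr1 -scalerA !scalerK.
congr (_ *: _); under [RHS]eq_bigr => a _ do under eq_bigr => b _ do
  rewrite /fourier scalerA mulrC -scalerA scaler_sumr.
under [RHS]eq_bigr do rewrite -scaler_sumr.
rewrite -scaler_sumr; congr (_ *: _).
under [LHS]eq_bigr => r' _ do under eq_bigr => s' _ do
  (rewrite scaler_suml; under eq_bigr do rewrite scaler_suml).
rewrite [RHS](eq_bigr (fun a => \sum_r' \sum_s' \sum_b
  (sgn4 a r * sgn4 a r' * (sgn4 b s * sgn4 b s')) *: u r' s')); last first.
  move=> a _; rewrite exchange_big; apply: eq_bigr => r' _.
  rewrite exchange_big /=; apply: eq_bigr => b _.
  rewrite scaler_sumr; apply: eq_bigr => s' _.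
  by rewrite scalerA mulrACA.
rewrite [RHS]exchange_big; apply: eq_bigr => r' _.
by rewrite [RHS]exchange_big.
Qed.

(** Inversion applied to [x]: the coefficients of an expansion in characters are determined by its
    values. *)
Lemma fourier_inj_sum u (x : 'I_4 -> 'I_4 -> A) :
  (forall r s, u r s = 4^-1 *: \sum_a \sum_b (sgn4 a r * sgn4 b s) *: x a b) ->
  fourier u =2 x.
Proof.
move=> uE a b; rewrite (fourierK x a b) /fourier.
congr (_ *: _); apply: eq_bigr => r _; apply: eq_bigr => s _.
rewrite sgn4C (sgn4C b) uE; congr (_ *: (_ *: _)).
by apply: eq_bigr => c _; apply: eq_bigr => d _; rewrite sgn4C (sgn4C d).
Qed.

Section RowRelations.
Variables (u : 'I_4 -> 'I_4 -> A) (urow : row_partition u).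
Let f b r := \sum_s sgn4 b s *: u r s.

Lemma fourierE a b : fourier u a b = 4^-1 *: \sum_r sgn4 a r *: f b r.
Proof.
rewrite /fourier; congr (_ *: _); apply: eq_bigr => r _.
by rewrite scaler_sumr; apply: eq_bigr => s _; rewrite scalerA.
Qed.

Lemma fourier_column0 a : fourier u a o0 = (a == o0)%:R.
Proof.
rewrite fourierE; under eq_bigr => r _.
  rewrite /f; under eq_bigr do rewrite /sgn4 /anticomm /= scale1r.
  rewrite urow.2; over.
rewrite -scaler_suml; under eq_bigr do rewrite sgn4C.
rewrite sum_anticomm scalerA mulrA mulVf ?pnatr_eq0 // mul1r.
by case: eqP; rewrite ?scale1r ?scale0r.
Qed.

(** Mutually orthogonal idempotents multiply coefficientwise, and the coefficients are
    characters. *)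
Let fM b b' r : f b r * f b' r = f (klein_add b b') r.
Proof.
rewrite /f mulr_suml; apply: eq_bigr => s _; rewrite mulr_sumr (bigD1 s) //=.
rewrite big1 => [|s' /negbTE s's]; last first.
  by rewrite -scalerAl -scalerAr urow.1 eq_sym s's scale0r !scaler0.
by rewrite -scalerAl -scalerAr urow.1 eqxx scale1r scalerA addr0 sgn4D.
Qed.

(** Transforming in the row index turns the pointwise product [fM] into a convolution: the sum over
    [a] forces the two row indices to agree. *)
Lemma fourier_row_rel : fourier_row_mul (fourier u).
Proof.
move=> c b b'; have four0 : (4 : C) != 0 by rewrite pnatr_eq0.
transitivity (4^-1 *: (4^-1 *: \sum_r \sum_r'
   (\sum_a sgn4 a r * sgn4 a r') *: (sgn4 c r' *: (f b r * f b' r')))).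
  have -> : \sum_r \sum_r'
      (\sum_a sgn4 a r * sgn4 a r') *: (sgn4 c r' *: (f b r * f b' r')) =
      \sum_a \sum_r \sum_r'
        (sgn4 a r * sgn4 a r' * sgn4 c r') *: (f b r * f b' r').
    rewrite [RHS]exchange_big; apply: eq_bigr => r _.
    rewrite [RHS]exchange_big; apply: eq_bigr => r' _.
    by rewrite scaler_suml; apply: eq_bigr => a _; rewrite scalerA.
  rewrite scalerA scaler_sumr; apply: eq_bigr => a _.
  rewrite !fourierE -scalerAl -scalerAr scalerA; congr (_ *: _).
  rewrite mulr_suml; apply: eq_bigr => r _; rewrite mulr_sumr.
  apply: eq_bigr => r' _; rewrite -scalerAl -scalerAr !scalerA sgn4D.
  by rewrite !mulrA.
rewrite [RHS]fourierE; congr (_ *: _); rewrite scaler_sumr.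
apply: eq_bigr => r _; rewrite (bigD1 r) //=.
rewrite [X in _ + X]big1 => [|r' /negbTE r'r]; last first.
  under eq_bigr do rewrite sgn4C (sgn4C _ r').
  by rewrite sum_sgn4 eq_sym r'r mulr0 scale0r.
under eq_bigr do rewrite sgn4C.
by rewrite sum_sgn4 eqxx mulr1 addr0 scalerK // fM.
Qed.

End RowRelations.

End Fourier.

(** The magic relations after the transform. They contain no denominators and make sense in any
    ring. *)
Definition magic_coeffs (A : nzRingType) (x : 'I_4 -> 'I_4 -> A) : Prop :=
  [/\ x o0 o0 = 1, forall a, a != o0 -> x a o0 = 0 /\ x o0 a = 0,
      forall c b b',
        \sum_a x a b * x (klein_add a c) b' = x c (klein_add b b') &
      forall c a a',
        \sum_b x a b * x a' (klein_add b c) = x (klein_add a a') c].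

Lemma magic_coeffs_tr (A : nzRingType) (x : 'I_4 -> 'I_4 -> A) :
  magic_coeffs x -> magic_coeffs (fun a b => x b a).
Proof. by case=> x00 x0 row col; split=> // a /x0[]. Qed.

Section MagicCoeffs.
Variables (A : nzRingType) (x : 'I_4 -> 'I_4 -> A) (xm : magic_coeffs x).

(** In the main case the column convolution with [a = a'] and shift [klein_add b b'] has value 0;
    two of its four terms vanish, and the other two are the products in both orders. *)
Lemma magic_coeffs_row_anticomm a b b' :
  x a b * x a b' = (-1) ^+ anticomm b b' * (x a b' * x a b).
Proof.
have [x00 x0 _ col] := xm.
have [->|b'b] := eqVneq b b'; first by rewrite /anticomm eqxx !andbF mul1r.
have [->|a0] := eqVneq a o0.
  have z c c' : c != c' -> x o0 c * x o0 c' = 0.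
    have [->|/x0[_ ->]] := eqVneq c o0; last by rewrite mul0r.
    by rewrite eq_sym => /x0[_ ->]; rewrite mulr0.
  by rewrite (z _ _ b'b) z 1?eq_sym // mulr0.
have [->|b0] := eqVneq b o0; first by rewrite (x0 a a0).1 mul0r mulr0 mulr0.
have [->|b'0] := eqVneq b' o0; first by rewrite (x0 a a0).1 mul0r !mulr0.
rewrite /anticomm b0 b'0 b'b /= expr1 mulN1r; apply/eqP.
rewrite -subr_eq0 opprK.
have := col (klein_add b b') a a; rewrite klein_addNr.
rewrite (x0 _ _).2 ?klein_add_eq0 // (sum_klein _ b0 b'0 b'b).
rewrite (x0 a a0).1 mul0r add0r klein_addNr (x0 a a0).1 mulr0 add0r.
by rewrite klein_addKr (klein_addC b b') klein_addKr => ->.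
Qed.

(** The cofactor identity of SO(3) with a twisted sign: two of the four terms of the row convolution
    involve the border and vanish. *)
Lemma magic_coeffs_minor a a' b b' :
  a != o0 -> a' != o0 -> a != a' -> b != o0 -> b' != o0 ->
  x a b * x a' b' + x a' b * x a b' = x (klein_add a a') (klein_add b b').
Proof.
have [x00 x0 row _] := xm; move=> a0 a'0 aa' b0 b'0.
rewrite -(row _ b b') (sum_klein _ a0 a'0 aa') klein_addNr.
rewrite (x0 b b0).2 (x0 b' b'0).2 mul0r mulr0 !add0r klein_addKr.
by rewrite (klein_addC a a') klein_addKr.
Qed.

End MagicCoeffs.

Section MagicCoeffsComm.
Variables (A : nzRingType) (x : 'I_4 -> 'I_4 -> A) (xm : magic_coeffs x).

(** If rows and columns are distinct and nonzero, [x] and its transpose give two expansions of the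
    same cofactor with one term in common; cancelling it shows that the entries commute. *)
Lemma magic_coeffs_comm a a' b b' :
  x a b * x a' b' =
  (-1) ^+ (anticomm a a' (+) anticomm b b') * (x a' b' * x a b).
Proof.
have [x00 x0 row col] := xm; have xt := magic_coeffs_tr xm.
have [<-|aa'] := eqVneq a a'.
  rewrite (_ : anticomm a a = false) ?addFb; last by rewrite /anticomm eqxx !andbF.
  exact: magic_coeffs_row_anticomm.
have [<-|bb'] := eqVneq b b'.
  rewrite (_ : anticomm b b = false) ?addbF; last by rewrite /anticomm eqxx !andbF.
  exact: (magic_coeffs_row_anticomm xt).
have deg u v : (u == o0) || (v == o0) -> x u v = ((u == o0) && (v == o0))%:R.
  have [->|u0] := eqVneq u o0.
    by have [->|/x0[_ ->]] := eqVneq v o0; rewrite ?x00.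
  by move=> /eqP ->; case: (x0 u u0).
have degC u v u' v' : (u == o0) || (v == o0) -> x u v * x u' v' =
    (-1) ^+ (anticomm u u' (+) anticomm v v') * (x u' v' * x u v).
  move=> /deg ->; have [/andP[/eqP-> /eqP->]|_] := boolP (_ && _).
    by rewrite mulr1 !mul1r.
  by rewrite mul0r !mulr0.
have [/degC //|] := boolP ((a == o0) || (b == o0)); rewrite negb_or => /andP[a0 b0].
have [/degC ->|] := boolP ((a' == o0) || (b' == o0)).
  by rewrite anticommC (anticommC b') mulrA -expr2 sqrr_sign mul1r.
rewrite negb_or => /andP[a'0 b'0].
rewrite {1 2}/anticomm a0 a'0 aa' b0 b'0 bb' /= mul1r.
have := magic_coeffs_minor xm a'0 a0 (contra_neq (@esym _ _ _) aa') b0 b'0.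
have := magic_coeffs_minor xt b0 b'0 bb' a'0 a0.
by rewrite /= => <- /addrI.
Qed.

End MagicCoeffsComm.

Lemma fourier_magic (C : numFieldType) (A : algType C) (u : 'I_4 -> 'I_4 -> A) :
  row_partition u -> row_partition (fun r s => u s r) ->
  magic_coeffs (fourier u).
Proof.
move=> urow ucol; have tr a b := fourier_tr u a b; split.
- by rewrite (fourier_column0 urow).
- move=> a a0; split; first by rewrite (fourier_column0 urow) (negbTE a0).
  by rewrite tr (fourier_column0 ucol) (negbTE a0).
- exact: fourier_row_rel.
- move=> c a a'; under eq_bigr do rewrite !tr.
  by rewrite (fourier_row_rel ucol) tr.
Qed.

(** * Untwisting *)

Section Tensor.
Variables (C : numFieldType) (A : algType C) (m : nat).
Implicit Types (x : A) (T : 'M[C]_m.+1).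

(** The pure tensor of [x] and [T], with the tensor product of [A] and a matrix algebra realised as
    matrices over [A]. *)
Definition tensor x T : 'M[A]_m.+1 := \matrix_(i, j) (T i j *: x).

Lemma tensorM x x' T T' : tensor x T * tensor x' T' = tensor (x * x') (T * T').
Proof.
apply/matrixP => i j; rewrite !mxE scaler_suml; apply: eq_bigr => k _.
by rewrite !mxE -scalerAl -scalerAr scalerA.
Qed.

Lemma tensor_sum (I : Type) (r : seq I) (P : pred I) (F : I -> A) T :
  tensor (\sum_(i <- r | P i) F i) T = \sum_(i <- r | P i) tensor (F i) T.
Proof.
apply/matrixP => i j; rewrite mxE summxE scaler_sumr.
by apply: eq_bigr => k _; rewrite mxE.
Qed.

Lemma tensorD x x' T : tensor (x + x') T = tensor x T + tensor x' T.
Proof. by apply/matrixP => i j; rewrite !mxE scalerDr. Qed.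

Lemma tensorZ c x T : tensor (c *: x) T = tensor x (c *: T).
Proof. by apply/matrixP => i j; rewrite !mxE scalerA mulrC. Qed.

Lemma tensorN x T : tensor x (- T) = - tensor x T.
Proof. by apply/matrixP => i j; rewrite !mxE scaleNr. Qed.

Lemma tensor_sign (b : bool) x T : tensor ((-1) ^+ b * x) T = tensor x ((-1) ^+ b * T).
Proof.
case: b; rewrite ?mul1r // !mulN1r.
by apply/matrixP => i j; rewrite !mxE scalerN scaleNr.
Qed.

Lemma tensor0 T : tensor 0 T = 0.
Proof. by apply/matrixP => i j; rewrite !mxE scaler0. Qed.

Lemma tensor1 : tensor 1 1 = 1.
Proof.
by apply/matrixP => i j; rewrite !mxE; case: eqP; rewrite ?scale1r ?scale0r.
Qed.

Lemma tensor_eq0 x T T' : T * T' = 1 -> tensor x T = 0 -> x = 0.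
Proof.
move=> T1 /(congr1 (fun M => M * tensor 1 T')); rewrite tensorM T1 mulr1 mul0r.
by move=> /matrixP/(_ 0 0); rewrite !mxE eqxx scale1r.
Qed.

Lemma tensor_alg c : tensor c%:A 1 = (c%:A)%:M.
Proof.
apply/matrixP => i j; rewrite !mxE; case: eqP => _; last by rewrite scale0r.
by rewrite scale1r.
Qed.

End Tensor.

Section Untwist.
Variables (C : numFieldType) (A : algType C) (m : nat).
Implicit Types (x : 'I_4 -> 'I_4 -> A) (L R : 'I_4 -> 'M[C]_m.+1).

Definition untwist x L R (a b : 'I_4) : 'M[A]_m.+1 := tensor (x a b) (L a * R b).

Lemma mul_commuting_pairs L R a b a' b' : (forall a b, GRing.comm (L a) (R b)) ->
  (L a * R b) * (L a' * R b') = (L a * L a') * (R b * R b').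
Proof. by move=> LR; rewrite mulrA -(mulrA (L a)) -LR !mulrA. Qed.

Lemma untwist_tr x L R a b : (forall a b, GRing.comm (L a) (R b)) ->
  untwist x L R a b = untwist (fun a b => x b a) R L b a.
Proof. by move=> LR; rewrite /untwist LR. Qed.

(** Both tensor factors commute up to the same sign, which therefore cancels. *)
Lemma untwist_comm x L R a b a' b' : magic_coeffs x ->
  quaternion_units L -> quaternion_units R ->
  (forall a b, GRing.comm (L a) (R b)) ->
  GRing.comm (untwist x L R a b) (untwist x L R a' b').
Proof.
move=> xm Lq Rq LR.
rewrite /GRing.comm /untwist !tensorM (magic_coeffs_comm xm) tensor_sign.
congr tensor; rewrite !mul_commuting_pairs //.
rewrite (quaternion_units_anticomm Lq a a') (quaternion_units_anticomm Rq b b').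
case: (anticomm a a'); case: (anticomm b b') => /=;
  by rewrite ?expr1 ?expr0 ?mulN1r ?mul1r ?mulNr ?mulrN ?opprK.
Qed.

(** For nonzero [a] and [b], every nonzero [c] has [R c * R c = -1], so the matrix factor
    [- (L a * L b)] comes out of the sum, and the column convolution with shift 0 evaluates the
    rest. *)
Lemma untwist_row_orth x L R a b : magic_coeffs x ->
  quaternion_units L -> quaternion_units R ->
  (forall a b, GRing.comm (L a) (R b)) ->
  \sum_c untwist x L R a c * untwist x L R b c = (a == b)%:R.
Proof.
move=> xm Lq Rq LR; have [x00 x0 _ col] := xm.
have [L0 LL _] := Lq; have [R0 RR _] := Rq.
have sum0 d : \sum_c untwist x L R o0 c * untwist x L R d c = (o0 == d)%:R.
  rewrite (bigD1 o0) //= big1 => [|c c0]; last first.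
    by rewrite {1}/untwist (x0 c c0).2 tensor0 mul0r.
  rewrite /untwist x00 L0 R0 mulr1 tensor1 mul1r addr0.
  have [->|d0] := eqVneq d o0; first by rewrite x00 L0 mulr1 tensor1.
  by rewrite (x0 d d0).1 tensor0.
have [->|a0] := eqVneq a o0; first exact: sum0.
have [->|b0] := eqVneq b o0.
  rewrite eq_sym -sum0; apply: eq_bigr => c _; exact: untwist_comm.
have term c : untwist x L R a c * untwist x L R b c =
    tensor (x a c * x b c) (- (L a * L b)).
  rewrite /untwist tensorM mul_commuting_pairs //.
  have [->|c0] := eqVneq c o0; first by rewrite (x0 a a0).1 mul0r !tensor0.
  by rewrite RR // mulrN1.
under eq_bigr do rewrite term.
rewrite -tensor_sum; have := col o0 a b; under eq_bigr do rewrite klein_add0.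
move=> ->; have [<-|ab] := eqVneq a b.
  by rewrite klein_addNr x00 LL // opprK tensor1.
by rewrite (x0 _ _).1 ?klein_add_eq0 // tensor0.
Qed.

(** Reversing the product of two successive units [L] changes the plus sign of [magic_coeffs_minor]
    into the minus sign of a determinant. *)
Lemma untwist_minor x L R a b : magic_coeffs x ->
  quaternion_units L -> quaternion_units R ->
  (forall a b, GRing.comm (L a) (R b)) -> a != o0 -> b != o0 ->
  let y := untwist x L R in
  y (next3 (next3 a)) (next3 (next3 b)) =
  y a b * y (next3 a) (next3 b) - y (next3 a) b * y a (next3 b).
Proof.
move=> xm Lq Rq LR a0 b0 y; have [_ _ Ln] := Lq; have [_ _ Rn] := Rq.
have next0 c : c != o0 -> next3 c != o0 by elim/ord4P: c.
have next_neq c : c != o0 -> c != next3 c by elim/ord4P: c.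
have add_next c : c != o0 -> klein_add c (next3 c) = next3 (next3 c).
  by elim/ord4P: c.
rewrite /y /untwist !tensorM !mul_commuting_pairs // Ln // Rn //.
rewrite (quaternion_units_next_rev Lq a0) mulNr tensorN opprK -tensorD.
by rewrite magic_coeffs_minor ?next0 ?next_neq // !add_next.
Qed.

End Untwist.

Lemma untwist_special_orthogonal (C : numFieldType) (A : algType C) m
    (x : 'I_4 -> 'I_4 -> A) (L R : 'I_4 -> 'M[C]_m.+1) :
  magic_coeffs x -> quaternion_units L -> quaternion_units R ->
  (forall a b, GRing.comm (L a) (R b)) ->
  exists (D : comNzRingType) (phi : {rmorphism C -> D})
    (f : {rmorphism D -> 'M[A]_m.+1}) (y : 'I_4 -> 'I_4 -> D),
  [/\ forall c, f (phi c) = (c%:A)%:M, forall a b, f (y a b) = untwist x L R a b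
    & special_orthogonal y].
Proof.
move=> xm Lq Rq LR.
pose iota : {rmorphism C -> 'M[A]_m.+1} := @scalar_mx A m.+1 \o in_alg A.
(* The scalars join the family, so that the commutative ring built from it also receives [C]. *)
pose fam (i : 'I_4 * 'I_4 + C) :=
  match i with inl p => untwist x L R p.1 p.2 | inr c => iota c end.
have iotaE c : iota c = tensor c%:A 1 by rewrite tensor_alg.
have iota_tens c z T : GRing.comm (iota c) (tensor z T).
  by rewrite /GRing.comm iotaE !tensorM mulr_algl mulr_algr mul1r mulr1.
have fam_comm i j : GRing.comm (fam i) (fam j).
  case: i => [p|c]; case: j => [q|d]; first exact: untwist_comm.
  - exact/commr_sym/iota_tens.
  - exact: iota_tens.
  - by rewrite /fam (iotaE d); exact: iota_tens.
have [D [f [f_inj fE]]] := commuting_subring_exists fam_comm.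
have [phi phiE] : exists h : {rmorphism C -> D}, forall c, f (h c) = iota c.
  by apply: rmorphism_lift => // c; exact: (fE (inr c)).
pose y a b := projT1 (cid (fE (inl (a, b)))).
have yE a b : f (y a b) = untwist x L R a b by rewrite /y; case: cid.
exists D, phi, f, y; split=> //.
have [x00 x0 _ _] := xm; have [L0 _ _] := Lq; have [R0 _ _] := Rq.
split.
- by apply: f_inj; rewrite yE /untwist x00 L0 R0 mulr1 tensor1 rmorph1.
- move=> a a0; split; apply: f_inj; rewrite yE /untwist rmorph0.
    by rewrite (x0 a a0).1 tensor0.
  by rewrite (x0 a a0).2 tensor0.
- move=> a b; split; apply: f_inj; rewrite rmorph_sum rmorph_nat.
    under eq_bigr do rewrite rmorphM !yE.
    exact: untwist_row_orth.
  (* Columns are rows of the transpose, with [L] and [R] exchanged. *)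
  under eq_bigr do rewrite rmorphM !yE !(untwist_tr _ _ _ LR).
  apply: untwist_row_orth => //; first exact: magic_coeffs_tr.
  by move=> u v; exact/commr_sym/LR.
- move=> a b a0 b0; apply: f_inj; rewrite rmorphB !rmorphM !yE.
  exact: untwist_minor.
Qed.

(** The degree for which the product of the operators along [s] is, up to sign, the operator with
    that index. *)
Definition word_degree (s : seq ('I_4 * 'I_4)) : 'I_4 * 'I_4 :=
  foldr (fun p d => (klein_add p.1 d.1, klein_add p.2 d.2)) (o0, o0) s.

(** * Independence of the operators and separation by rotations *)

Section Core.
Variables (C : numFieldType) (m : nat) (L R : 'I_4 -> 'M[C]_m.+1).
Hypotheses (Lq : quaternion_units L) (Rq : quaternion_units R).
Hypothesis LR : forall a b, GRing.comm (L a) (R b).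
Let T a b := L a * R b.

Lemma word_val_klein_units s : exists e : bool,
  word_val T s = (-1) ^+ e * T (word_degree s).1 (word_degree s).2.
Proof.
rewrite /word_val; elim: s => [|p s [e IH]].
  exists false; rewrite big_nil mul1r /T /=.
  by case: Lq Rq => -> _ _ [-> _ _]; rewrite mulr1.
rewrite big_cons IH /T.
have [e1 L1] := quaternion_unitsM Lq p.1 (word_degree s).1.
have [e2 R2] := quaternion_unitsM Rq p.2 (word_degree s).2.
exists (e (+) (e1 (+) e2)); rewrite [RHS]/=; move: L1 R2.
by case: e {IH} => /=; case: e1; case: e2 => /=;
  rewrite ?mulN1r ?mul1r ?mulrN mul_commuting_pairs // => -> ->;
  rewrite ?mulN1r ?mul1r ?mulrN ?mulNr ?opprK.
Qed.

Lemma klein_units_inv a b : exists T', T a b * T' = 1.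
Proof.
have inv (K : 'I_4 -> 'M[C]_m.+1) : quaternion_units K ->
    forall c, exists K', K c * K' = 1.
  move=> [K0 KK _] c; have [->|c0] := eqVneq c o0.
    by exists 1; rewrite K0 mulr1.
  by exists (- K c); rewrite mulrN KK // opprK.
have [L' LL'] := inv L Lq a; have [R' RR'] := inv R Rq b.
by exists (R' * L'); rewrite /T mulrA -(mulrA (L a)) RR' mulr1.
Qed.

(* Conjugation by [T e] multiplies [T p] by the value at [e] of a character
   determined by [p]: averaging against a character isolates one coefficient. *)
Lemma klein_units_free (c : 'I_4 * 'I_4 -> C) :
  \sum_p c p *: T p.1 p.2 = 0 -> forall p, c p = 0.
Proof.
move=> c0 d; pose sg (p e : 'I_4 * 'I_4) := sgn4 C p.1 e.1 * sgn4 C p.2 e.2.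
have T_sg e p : T e.1 e.2 * T p.1 p.2 = sg p e *: (T p.1 p.2 * T e.1 e.2).
  rewrite /T !mul_commuting_pairs // (quaternion_units_anticomm Lq e.1).
  rewrite (quaternion_units_anticomm Rq e.2) /sg /sgn4.
  rewrite !(anticommC _ e.1) !(anticommC _ e.2).
  case: (anticomm e.1 _); case: (anticomm e.2 _);
    by rewrite ?expr1 ?expr0 ?mulN1r ?mul1r ?mulNr ?mulrN ?opprK
      ?scaleN1r ?scale1r ?opprK.
pose inv e := projT1 (cid (klein_units_inv e.1 e.2)).
have invE e : T e.1 e.2 * inv e = 1 by rewrite /inv; case: cid.
have conj e : \sum_p (c p * sg p e) *: T p.1 p.2 = 0.
  transitivity (T e.1 e.2 * (\sum_p c p *: T p.1 p.2) * inv e); last first.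
    by rewrite c0 mulr0 mul0r.
  rewrite mulr_sumr mulr_suml.
  apply: eq_bigr => p _.
  by rewrite -[X in _ = X * _]scalerAr T_sg scalerA -[RHS]scalerAl -mulrA invE mulr1.
have : \sum_e sg d e *: \sum_p (c p * sg p e) *: T p.1 p.2 = 0.
  by rewrite big1 // => e _; rewrite conj scaler0.
under eq_bigr do rewrite scaler_sumr; rewrite exchange_big /=.
have orth p : \sum_e sg d e * sg p e = 16 * (d == p)%:R.
  rewrite -(pair_big predT predT (fun u v => sg d (u, v) * sg p (u, v))) /=.
  under eq_bigr do under eq_bigr do rewrite /sg /= mulrACA.
  under eq_bigr do rewrite -mulr_sumr sum_sgn4.
  rewrite -mulr_suml sum_sgn4 mulrACA -!natrM -pair_eqE /pair_eq /=.
  by rewrite mulnb.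
rewrite (bigD1 d) //= [X in _ + X]big1 => [|p /negbTE pd]; last first.
  under eq_bigr do rewrite scalerA mulrCA.
  by rewrite -scaler_suml -mulr_sumr orth eq_sym pd !mulr0 scale0r.
under eq_bigr do rewrite scalerA mulrCA.
rewrite -scaler_suml -mulr_sumr orth eqxx mulr1 addr0 => e.
have := congr1 (fun M => M * inv d) e; rewrite /= -scalerAl invE mul0r.
move/eqP; rewrite scaler_eq0 oner_eq0 orbF mulf_eq0 pnatr_eq0 orbF.
by move/eqP.
Qed.

Lemma word_valZ (D : algType C) (k : 'I_4 -> 'I_4 -> C) (y : 'I_4 -> 'I_4 -> D) s :
  word_val (fun a b => k a b *: y a b) s = word_val k s *: word_val y s.
Proof.
rewrite /word_val; elim: s => [|p s IH]; first by rewrite !big_nil scale1r.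
by rewrite !big_cons IH -scalerAl -scalerAr scalerA.
Qed.

(** The combination is split by degree. Independence of the operators turns the hypothesis into one
    scalar identity per degree, [word_vanish] transfers it to the untwisted entries, and the
    invertible operator of that degree is removed. *)
Theorem magic_coeffs_separation (A : algType C) (x : 'I_4 -> 'I_4 -> A)
    (r : seq (C * seq ('I_4 * 'I_4))) :
  magic_coeffs x ->
  (forall q : 'I_4 -> nat, let k := rotation (fun a => (q a).+1%:R : C) in
     \sum_(z <- r)
       z.1 *: word_val (fun a b => (k a b / k o0 o0) *: T a b) z.2 = 0) ->
  \sum_(z <- r) z.1 *: word_val x z.2 = 0.
Proof.
move=> xm r0; pose sg s := projT1 (cid (word_val_klein_units s)).
have sgE s : word_val T s =
    (-1) ^+ sg s *: T (word_degree s).1 (word_degree s).2.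
  rewrite /sg; case: cid => e /= ->.
  by case: (e); rewrite ?mulN1r ?mul1r ?scaleN1r ?scale1r.
have [D [phi [f [y [f_phi f_y yso]]]]] := untwist_special_orthogonal xm Lq Rq LR.
suff deg0 d : \sum_(z <- r | word_degree z.2 == d) z.1 *: word_val x z.2 = 0.
  rewrite (partition_big (fun z => word_degree z.2) predT) //=.
  by rewrite big1.
(* The sign of the operator product is stored in the coefficient; it meets itself again under [f]
   and squares to 1. *)
pose rd := [seq (z.1 * (-1) ^+ sg z.2, z.2) | z <- r & word_degree z.2 == d].
have rd0 : \sum_(z <- rd) phi z.1 * word_val y z.2 = 0.
  apply: word_vanish => // q k; rewrite big_map big_filter /=.
  pose kk s := word_val (fun a b => k a b / k o0 o0) s.
  apply: (@klein_units_free (fun d => \sum_(z <- r | word_degree z.2 == d)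
    z.1 * (-1) ^+ sg z.2 * kk z.2) _ d).
  rewrite -[RHS](r0 q) -/k.
  rewrite [RHS](partition_big (fun z => word_degree z.2) predT) //=.
  apply: eq_bigr => p _; rewrite scaler_suml; apply: eq_bigr => z /eqP zp.
  by rewrite word_valZ sgE zp !scalerA mulrAC.
have [T' TT'] := klein_units_inv d.1 d.2.
apply: (tensor_eq0 TT'); rewrite tensor_sum -[RHS](rmorph0 f) -rd0 rmorph_sum.
rewrite big_map big_filter; apply: eq_bigr => z /eqP zd.
rewrite rmorphM f_phi /= -tensor_alg.
have -> : f (word_val y z.2) = tensor (word_val x z.2) (word_val T z.2).
  rewrite /word_val rmorph_prod.
  elim: (z.2) => [|p s IH]; first by rewrite !big_nil tensor1.
  by rewrite !big_cons IH f_y /untwist tensorM.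
rewrite tensorM sgE zd mul1r mulr_algl !tensorZ scalerA; congr tensor.
by rewrite -mulrA -expr2 sqrr_sign mulr1.
Qed.

End Core.

(** * Quaternion matrices *)

Local Notation e0 := (@Ordinal 2 0 isT).
Local Notation e1 := (@Ordinal 2 1 isT).

Lemma ord2P (P : 'I_2 -> Prop) : P e0 -> P e1 -> forall a, P a.
Proof.
move=> P0 P1 [[|[|m]] lt_m2] //.
- by rewrite (_ : Ordinal _ = e0) //; apply/val_inj.
- by rewrite (_ : Ordinal _ = e1) //; apply/val_inj.
Qed.

Lemma sum_ord2 (V : nmodType) (F : 'I_2 -> V) : \sum_a F a = F e0 + F e1.
Proof.
rewrite !big_ord_recr big_ord0 /= add0r.
by congr (_ + _); congr F; apply/val_inj.
Qed.

Lemma mx2P (V : Type) (M N : 'M[V]_2) : M e0 e0 = N e0 e0 -> M e0 e1 = N e0 e1 ->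
  M e1 e0 = N e1 e0 -> M e1 e1 = N e1 e1 -> M = N.
Proof. by move=> *; apply/matrixP; elim/ord2P; elim/ord2P. Qed.

Section Mx22.
Variable R : realType.
Implicit Types a b c d : R[i].

Lemma mx22E a b c d i j :
  mx22 a b c d i j = nth 0 (nth [::] [:: [:: a; b]; [:: c; d]] i) j.
Proof. by rewrite mxE. Qed.

Lemma mx22_eta (m : 'M[R[i]]_2) : m = mx22 (m e0 e0) (m e0 e1) (m e1 e0) (m e1 e1).
Proof. by apply: mx2P; rewrite mxE. Qed.

Lemma mx22M a b c d a' b' c' d' : mx22 a b c d *m mx22 a' b' c' d' =
  mx22 (a * a' + b * c') (a * b' + b * d') (c * a' + d * c') (c * b' + d * d').
Proof. by apply: mx2P; rewrite mxE sum_ord2 !mx22E. Qed.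

Lemma mx22D a b c d a' b' c' d' : mx22 a b c d + mx22 a' b' c' d' =
  mx22 (a + a') (b + b') (c + c') (d + d').
Proof. by apply: mx2P; rewrite mxE !mx22E. Qed.

Lemma mx22Z k a b c d : k *: mx22 a b c d = mx22 (k * a) (k * b) (k * c) (k * d).
Proof. by apply: mx2P; rewrite mxE !mx22E. Qed.

Lemma mx22_adj a b c d : (mx22 a b c d)^t* = mx22 a^* c^* b^* d^*.
Proof. by apply: mx2P; rewrite mxE mxE !mx22E. Qed.

Lemma mx22_scalar a : a%:M = mx22 a 0 0 a.
Proof. by apply: mx2P; rewrite mxE mx22E. Qed.

Lemma mx22_det a b c d : \det (mx22 a b c d) = a * d - b * c.
Proof.
rewrite (expand_det_row _ e0) sum_ord2 !mx22E /cofactor !det_mx11 !mxE /=.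
by rewrite expr0 expr1 mul1r mulN1r mulrN.
Qed.

End Mx22.

Lemma adjmxM (C : numClosedFieldType) m n p (A : 'M[C]_(m, n)) (B : 'M[C]_(n, p)) :
  (A *m B)^t* = B^t* *m A^t*.
Proof. by rewrite trmx_mul map_mxM. Qed.

Lemma adjmxZ (C : numClosedFieldType) m n (c : C) (A : 'M[C]_(m, n)) :
  (c *: A)^t* = c^* *: A^t*.
Proof. by rewrite linearZ /= map_mxZ. Qed.

(** * Complex numbers as pairs of reals *)

Section ComplexPairs.
Variable R : realType.
Implicit Types a b c d : R.

Lemma complex_addE a b c d : (a +i* b + (c +i* d) = (a + c) +i* (b + d))%C.
Proof. by []. Qed.

Lemma complex_oppE a b : (- (a +i* b) = (- a) +i* (- b))%C.
Proof. by []. Qed.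

Lemma complex_mulE a b c d :
  ((a +i* b) * (c +i* d) = (a * c - b * d) +i* (a * d + b * c))%C.
Proof. by []. Qed.

Lemma complex_conjE a b : (a +i* b)%C^* = (a +i* (- b))%C.
Proof. by []. Qed.

Lemma complex0E : 0 = (0 +i* 0)%C :> R[i]. Proof. by []. Qed.

Lemma complex1E : 1 = (1 +i* 0)%C :> R[i]. Proof. by []. Qed.

Lemma complex2E : 2 = (2 +i* 0)%C :> R[i].
Proof. by rewrite -[2 in LHS](rmorph_nat (real_complex R)). Qed.

(** These rules expose real and imaginary parts, so that a complex identity becomes two real ones
    for [ring]. *)
Definition complex_pairE := (complex0E, complex1E, complex_mulE, complex_oppE,
  complex_addE, complex_conjE).

End ComplexPairs.

Section EndoMx.
Variable R : realType.
Local Notation C := R[i].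
Implicit Types f g : {linear 'M[C]_2 -> 'M[C]_2}.

Lemma endo_mx_ext (M N : 'M[C]_4) :
  (forall z : 'M[C]_2, M *m ((mxvec z)^T : 'cV_4) = N *m ((mxvec z)^T : 'cV_4)) ->
  M = N.
Proof.
move=> MN; apply/trmx_inj/row_matrixP => i; rewrite !rowE.
apply: trmx_inj; rewrite !trmx_mul !trmxK.
by have := MN (vec_mx (delta_mx 0 i : 'rV_(2 * 2))); rewrite vec_mxK.
Qed.

Lemma endo_mx_comp f g : endo_mx f *m endo_mx g = endo_mx (f \o g).
Proof.
by apply: endo_mx_ext => z; rewrite -mulmxA !endo_mxP.
Qed.

Lemma eq_endo_mx (f g : 'M[C]_2 -> 'M[C]_2) : f =1 g -> endo_mx f = endo_mx g.
Proof. by move/funext=> ->. Qed.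

End EndoMx.

(** * Quaternion multiplications and line projections *)

Section QuaternionMatrices.
Variable R : realType.
Local Notation C := R[i].
Let q (a : 'I_4) : 'M[C]_2 := tnth (quat R) a.

Lemma tnth_quatE a : tnth (quat R) a = match val a with
  | 0 => mx22 1 0 0 1 | 1 => mx22 'i%C 0 0 (- 'i%C)
  | 2 => mx22 0 1 (-1) 0 | _ => mx22 0 'i%C 'i%C 0 end.
Proof. by rewrite complexiE; elim/ord4P: a; rewrite (tnth_nth 0). Qed.

Lemma quat_units : quaternion_units q.
Proof.
split; rewrite /q.
- by rewrite tnth_quatE -mx22_scalar.
- rewrite (_ : -1 = mx22 (-1) 0 0 (-1)); last first.
    by rewrite -mx22_scalar -scalemx1 scaleN1r.
  by elim/ord4P => // _; rewrite tnth_quatE [LHS]mx22M; congr mx22;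
    rewrite !complex_pairE; congr (_ +i* _)%C; ring.
- by elim/ord4P => // _; rewrite !tnth_quatE [LHS]mx22M; congr mx22;
    rewrite !complex_pairE; congr (_ +i* _)%C; ring.
Qed.

Lemma quat_unitary a : q a *m (q a)^t* = 1%:M.
Proof.
by rewrite mx22_scalar /q; elim/ord4P: a;
  rewrite !tnth_quatE mx22_adj mx22M; congr mx22;
    rewrite !complex_pairE; congr (_ +i* _)%C; ring.
Qed.

(** Averaging over an irreducible group of unitaries projects onto the scalars and keeps the
    trace. *)
Lemma quat_twirl (m : 'M[C]_2) :
  \sum_a q a *m m *m (q a)^t* = (2 * \tr m)%:M.
Proof.
rewrite (mx22_eta m) sum_ord4 /q !tnth_quatE !mx22_adj /mxtrace sum_ord2.
rewrite !mx22M !mx22D !mx22E mx22_scalar /=.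
case: (m e0 e0) (m e0 e1) (m e1 e0) (m e1 e1) => [a b] [a1 b1] [a2 b2] [a3 b3].
by congr mx22; rewrite ?complex2E !complex_pairE; congr (_ +i* _)%C; ring.
Qed.

Definition quat_comb (t : 'I_4 -> R) : 'M[C]_2 := \sum_a (t a)%:C%C *: q a.

Lemma quat_combE t : quat_comb t =
  mx22 (t o0 +i* t o1)%C (t o2 +i* t o3)%C (- t o2 +i* t o3)%C (t o0 +i* - t o1)%C.
Proof.
rewrite /quat_comb sum_ord4 /q !tnth_quatE !mx22Z !mx22D; congr mx22;
  by rewrite !complex_pairE; congr (_ +i* _)%C; ring.
Qed.

(** This gives the table [rotation] its meaning; the units appear with adjoints, as in the right
    multiplications below. *)
Lemma quat_comb_conj t a : (quat_comb t)^t* *m (q a)^t* *m quat_comb t =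
  \sum_b (rotation t a b)%:C%C *: (q b)^t*.
Proof.
rewrite quat_combE sum_ord4 /q !tnth_quatE.
elim/ord4P: a; rewrite /= !mx22_adj !mx22Z !mx22D !mx22M; congr mx22.
all: rewrite !complex_pairE; congr (_ +i* _)%C; rewrite /rotation /=; ring.
Qed.

Lemma quat_adj_unitary a : (q a)^t* *m q a = 1%:M.
Proof. exact/mulmx1C/quat_unitary. Qed.

Lemma quat_adj_anticomm a r :
  (q r)^t* *m (q a)^t* *m q r = (sgn4 C a r) *: (q a)^t*.
Proof.
have qC : q a *m q r = sgn4 C a r *: (q r *m q a).
  rewrite [LHS](quaternion_units_anticomm quat_units) /sgn4.
  by case: (anticomm a r); rewrite ?mulN1r ?mul1r ?scaleN1r ?scale1r.
have conj_sgn : (sgn4 C a r)^* = sgn4 C a r.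
  by rewrite /sgn4; case: (anticomm a r); rewrite ?rmorphN1 ?rmorph1.
rewrite -adjmxM qC adjmxZ conj_sgn adjmxM -scalemxAl.
by rewrite -mulmxA quat_adj_unitary mulmx1.
Qed.

Let L a := endo_mx (mulmx (q a)).
(** The adjoint compensates the reversal of products by right multiplication. *)
Let Rt a := endo_mx (mulmxr ((q a)^t*)).

Lemma endo_lmul_units : quaternion_units L.
Proof.
have [q0 qq qn] := quat_units; split; rewrite /L.
- apply: endo_mx_ext => z; rewrite (@endo_mxP R (mulmx (q o0))) mul1mx /=.
  by have -> : q o0 *m z = z by rewrite q0 mul1mx.
- move=> a a0; rewrite [LHS]endo_mx_comp; apply: endo_mx_ext => z.
  rewrite (@endo_mxP R (mulmx (q a) \o mulmx (q a))) /= mulmxA.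
  have -> : q a *m q a = -1 := qq a a0.
  by rewrite !mulNmx !mul1mx !linearN.
- move=> a a0; rewrite [LHS]endo_mx_comp; apply: eq_endo_mx => z /=.
  by rewrite mulmxA; congr (_ *m _); exact: qn.
Qed.

Lemma endo_rmul_units : quaternion_units Rt.
Proof.
have [q0 qq qn] := quat_units; split; rewrite /Rt.
- apply: endo_mx_ext => z; rewrite (@endo_mxP R (mulmxr ((q o0)^t*))) mul1mx /=.
  by have -> : z *m (q o0)^t* = z by rewrite q0 trmx1 map_mx1 mulmx1.
- move=> a a0; rewrite [LHS]endo_mx_comp; apply: endo_mx_ext => z.
  rewrite (@endo_mxP R (mulmxr ((q a)^t*) \o mulmxr ((q a)^t*))) /= -mulmxA.
  have -> : (q a)^t* *m (q a)^t* = -1.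
    rewrite -adjmxM (qq a a0 : q a *m q a = -1).
    have -> : -1 = (-1) *: 1%:M :> 'M[C]_2 by rewrite scaleN1r.
    by rewrite adjmxZ trmx1 map_mx1 rmorphN1.
  by rewrite mulmxN mulNmx mulmx1 mul1mx !linearN.
- move=> a a0; rewrite [LHS]endo_mx_comp; apply: eq_endo_mx => z /=.
  by rewrite -mulmxA -adjmxM; congr (_ *m _^t*); exact: qn.
Qed.

Lemma endo_lrmulC a b : GRing.comm (L a) (Rt b).
Proof.
rewrite /GRing.comm [LHS]endo_mx_comp [RHS]endo_mx_comp.
by apply: eq_endo_mx => z /=; rewrite mulmxA.
Qed.

Lemma line_proj_unitary (y z : 'M[C]_2) : y \is unitarymx ->
  line_proj y z = (2^-1 * \tr (z *m y^t*)) *: y.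
Proof.
move/unitarymxP => yy; rewrite /line_proj /hs_form yy mxtrace1.
by rewrite mulVf ?pnatr_eq0 // divr1.
Qed.

(** The trace in the formula for the projection is replaced by the twirl of [z *m y^t*]. *)
Lemma line_proj_quat (y z : 'M[C]_2) : y \is unitarymx ->
  line_proj y z = 4^-1 *: \sum_a q a *m z *m (y^t* *m (q a)^t* *m y).
Proof.
move=> yu; rewrite line_proj_unitary //.
have -> : \sum_a q a *m z *m (y^t* *m (q a)^t* *m y) =
    (\sum_a q a *m (z *m y^t*) *m (q a)^t*) *m y.
  by rewrite mulmx_suml; apply: eq_bigr => a _; rewrite !mulmxA.
rewrite quat_twirl mul_scalar_mx scalerA mulrA; congr (_ * _ *: _).
by rewrite -[4]/(2 * 2)%:R natrM invfM mulfVK ?pnatr_eq0.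
Qed.

Lemma line_proj_quat_lr (x z : 'M[C]_2) (k : 'I_4 -> 'I_4 -> C) r s :
  x \is unitarymx ->
  (forall a, x^t* *m (q a)^t* *m x = \sum_b k a b *: (q b)^t*) ->
  line_proj (q r *m x *m q s) z =
  4^-1 *: \sum_a \sum_b (sgn4 C a r * sgn4 C b s * k a b) *: (q a *m z *m (q b)^t*).
Proof.
move=> xu xk; rewrite line_proj_quat; last first.
  by rewrite !mul_unitarymx //; apply/unitarymxP; exact: quat_unitary.
congr (_ *: _); apply: eq_bigr => a _.
have -> : (q r *m x *m q s)^t* *m (q a)^t* *m (q r *m x *m q s) =
    \sum_b (sgn4 C a r * sgn4 C b s * k a b) *: (q b)^t*.
  transitivity ((q s)^t* *m (x^t* *m ((q r)^t* *m (q a)^t* *m q r) *m x) *m q s).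
    by rewrite !adjmxM !mulmxA.
  rewrite quat_adj_anticomm -scalemxAr -scalemxAl xk -scalemxAr -scalemxAl.
  rewrite mulmx_sumr mulmx_suml scaler_sumr; apply: eq_bigr => b _.
  rewrite -scalemxAr -scalemxAl quat_adj_anticomm !scalerA.
  by rewrite mulrAC.
by rewrite mulmx_sumr; apply: eq_bigr => b _; rewrite -scalemxAr.
Qed.

Lemma line_proj_linear (y : 'M[C]_2) : linear (line_proj y).
Proof.
move=> c z z'; rewrite /line_proj hs_form_linear mulrDl scalerDl -mulrA.
by rewrite scalerA.
Qed.

HB.instance Definition _ (y : 'M[C]_2) :=
  GRing.isLinear.Build C 'M[C]_2 'M[C]_2 _ (line_proj y) (line_proj_linear y).

Lemma line_proj_mxE (y z : 'M[C]_2) :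
  line_proj_mx y *m ((mxvec z)^T : 'cV_4) = (mxvec (line_proj y z))^T.
Proof. exact: (endo_mxP (line_proj y)). Qed.

(** Conjugating by [q r] and [q s] only produces characters, so this is the Fourier expansion of the
    matrix of projections. *)
Lemma line_proj_mx_quat (x : 'M[C]_2) (k : 'I_4 -> 'I_4 -> C) r s :
  x \is unitarymx ->
  (forall a, x^t* *m (q a)^t* *m x = \sum_b k a b *: (q b)^t*) ->
  line_proj_mx (q r *m x *m q s) =
  4^-1 *: \sum_a \sum_b (sgn4 C a r * sgn4 C b s) *: (k a b *: (L a * Rt b)).
Proof.
move=> xu xk; apply: endo_mx_ext => z.
rewrite line_proj_mxE (line_proj_quat_lr _ _ _ xu xk).
have vZ c (w : 'M[C]_2) : (mxvec (c *: w))^T = c *: (mxvec w)^T.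
  by rewrite !linearZ.
have vS (F : 'I_4 -> 'M[C]_2) : (mxvec (\sum_a F a))^T = \sum_a (mxvec (F a))^T.
  by rewrite !linear_sum.
rewrite -scalemxAl mulmx_suml vZ vS; congr (_ *: _).
apply: eq_bigr => a _; rewrite mulmx_suml vS; apply: eq_bigr => b _.
rewrite scalerA -scalemxAl vZ; congr (_ *: _).
rewrite -[L a * Rt b]/(L a *m Rt b) endo_mx_comp.
by rewrite (@endo_mxP R (mulmx (q a) \o mulmxr ((q b)^t*))) /= mulmxA.
Qed.

(** Both [x^* x] and the determinant are given by the squared norm, the entry (0, 0) of
    [rotation]. *)
Lemma quat_comb_unitary t : rotation t o0 o0 = 1 -> SU R 2 (quat_comb t).
Proof.
move=> t1; split.
  apply/unitarymxP; apply: mulmx1C.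
  have := quat_comb_conj t o0; rewrite sum_ord4 {1 2}/q.
  have [q0 _ _] := quat_units; rewrite -/(q o0) q0 trmx1 map_mx1 mulmx1 => ->.
  by rewrite t1 /rotation /= !scale0r !addr0 scale1r.
rewrite quat_combE mx22_det; move: t1; rewrite /rotation /= => t1.
rewrite !complex_pairE; congr (_ +i* _)%C; last by ring.
by rewrite -t1; ring.
Qed.

End QuaternionMatrices.

(** * The Pauli matrix *)

Section OrthonormalBasis.
Variable R : realType.
Local Notation C := R[i].

Definition vecmx (y : 'M[C]_2) : 'cV[C]_4 := (mxvec y)^T.

Lemma mxvec_mul_tr m n (A B : 'M[C]_(m, n)) :
  mxvec A *m (mxvec B)^T = (\tr (A *m B^T))%:M.
Proof.
apply/matrixP => i j; rewrite !ord1 !mxE mulr1n /mxtrace.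
rewrite (reindex _ (curry_mxvec_bij _ _)) /=.
under [RHS]eq_bigr do rewrite mxE.
rewrite pair_bigA; apply: eq_bigr => [[u v]] /= _.
by rewrite !mxE !mxvecE.
Qed.

Lemma vecmx_adj_mul (y z : 'M[C]_2) :
  (vecmx y)^t* *m vecmx z = (2 * hs_form z y)%:M.
Proof.
have -> : (vecmx y)^t* = mxvec ((y^t*)^T).
  by rewrite /vecmx trmxK map_trmx trmxK; exact: (@map_mxvec _ _ Num.Def.conjC 2 2 y).
rewrite [LHS](mxvec_mul_tr ((y^t*)^T) z).
by rewrite -trmx_mul mxtrace_tr /hs_form mulrA divff ?pnatr_eq0 // mul1r.
Qed.

(** The factor [2^-1] appears because [vecmx y] has squared length 2 for the standard inner
    product. *)
Lemma line_proj_mx_vecmx (y : 'M[C]_2) : hs_form y y = 1 ->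
  line_proj_mx y = 2^-1 *: (vecmx y *m (vecmx y)^t*).
Proof.
move=> y1; apply: endo_mx_ext => z; rewrite line_proj_mxE /line_proj y1 divr1.
rewrite -scalemxAl -mulmxA -/(vecmx z) vecmx_adj_mul mul_mx_scalar scalerA.
by rewrite mulKf ?pnatr_eq0 // !linearZ.
Qed.

Variable y : 'I_4 -> 'M[C]_2.
Hypothesis y_orthonormal : forall i j, hs_form (y i) (y j) = (i == j)%:R.
Let P i := line_proj_mx (y i).

Lemma line_proj_mx_mul i j : P i *m P j = (i == j)%:R *: P i.
Proof.
rewrite /P !line_proj_mx_vecmx ?y_orthonormal ?eqxx //.
rewrite -scalemxAl -scalemxAr !scalerA mulmxA -(mulmxA (vecmx (y i))).
rewrite vecmx_adj_mul y_orthonormal mul_mx_scalar -scalemxAl scalerA eq_sym.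
case: eqP => [->|_]; last by rewrite !mulr0 mul0r !scale0r.
by rewrite mulr1 mul1r mulfVK ?pnatr_eq0.
Qed.

Lemma line_proj_mx_adj i : (P i)^t* = P i.
Proof.
rewrite /P line_proj_mx_vecmx ?y_orthonormal ?eqxx // adjmxZ adjmxM trmxCK.
by rewrite fmorphV rmorph_nat.
Qed.

(** Orthonormality gives the square matrix [V] of the vectors a left inverse, which is also a right
    inverse; that product is the sum of the projections. *)
Lemma sum_line_proj_mx : \sum_i P i = 1%:M.
Proof.
pose V : 'M[C]_4 := \matrix_(k, i) vecmx (y i) k 0.
have VV : (2^-1 *: V^t*) *m V = 1%:M.
  apply/matrixP => i j; have := vecmx_adj_mul (y i) (y j).
  move/matrixP => /(_ 0 0); rewrite y_orthonormal !mxE mulr1n eq_sym => e.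
  rewrite -[RHS](mulKf (_ : 2 != 0)) ?pnatr_eq0 // -e mulr_sumr.
  by apply: eq_bigr => k _; rewrite !mxE mulrA.
rewrite -(mulmx1C VV) -scalemxAr; apply/matrixP => k l.
rewrite summxE !mxE mulr_sumr; apply: eq_bigr => i _.
rewrite /P line_proj_mx_vecmx ?y_orthonormal ?eqxx // !mxE big_ord1.
by rewrite !mxE.
Qed.

End OrthonormalBasis.

(** * Orthonormality, continuity and the magic relations *)

Section PauliMagic.
Variable R : realType.
Local Notation C := R[i].
Let q (a : 'I_4) : 'M[C]_2 := tnth (quat R) a.

Lemma quat_orthonormal a b : hs_form (q a) (q b) = (a == b)%:R.
Proof.
have two0 : 2 != 0 :> C by rewrite pnatr_eq0.
suff trE : \tr (q a *m (q b)^t*) = 2 * (a == b)%:R by rewrite /hs_form trE mulKf.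
rewrite /mxtrace sum_ord2 /q; elim/ord4P: a; elim/ord4P: b;
  rewrite !tnth_quatE mx22_adj mx22M !mx22E /= ?mulr1n ?mulr0n complex2E;
  by rewrite !complex_pairE; congr (_ +i* _)%C; ring.
Qed.

Lemma hs_form_unitary_r (x z t : 'M[C]_2) :
  x \is unitarymx -> hs_form (z *m x) (t *m x) = hs_form z t.
Proof.
by move=> /unitarymxP xx; rewrite /hs_form adjmxM mulmxA -(mulmxA z) xx mulmx1.
Qed.

Lemma hs_form_unitary_l (x z t : 'M[C]_2) :
  x^t* \is unitarymx -> hs_form (x *m z) (x *m t) = hs_form z t.
Proof.
move=> /unitarymxP; rewrite trmxCK => xx; rewrite /hs_form adjmxM.
by rewrite mxtrace_mulC !mulmxA -(mulmxA _ (x^t*)) xx mulmx1 mxtrace_mulC.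
Qed.

Lemma quat_is_unitary a : q a \is unitarymx.
Proof. by apply/unitarymxP; exact: quat_unitary. Qed.

Lemma quat_adj_is_unitary a : (q a)^t* \is unitarymx.
Proof. by apply/unitarymxP; rewrite trmxCK; exact: quat_adj_unitary. Qed.

Lemma pauli_row_orthonormal (x : 'M[C]_2) r s s' : x \is unitarymx ->
  hs_form (q r *m x *m q s) (q r *m x *m q s') = (s == s')%:R.
Proof.
move=> xu; have xu' : x^t* \is unitarymx.
  by apply/unitarymxP; rewrite trmxCK; apply: mulmx1C; exact/unitarymxP.
rewrite -!mulmxA hs_form_unitary_l ?quat_adj_is_unitary //.
by rewrite hs_form_unitary_l // quat_orthonormal.
Qed.

Lemma pauli_col_orthonormal (x : 'M[C]_2) r r' s : x \is unitarymx ->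
  hs_form (q r *m x *m q s) (q r' *m x *m q s) = (r == r')%:R.
Proof.
by move=> xu; rewrite !hs_form_unitary_r ?quat_is_unitary // quat_orthonormal.
Qed.

(** For unit vectors the rank-one formula expresses the projection without division. *)
Lemma pauli_continuous r s :
  continuous (fun x : SU R 2 => line_proj_mx (q r *m \val x *m q s)).
Proof.
pose y (x : SU R 2) := q r *m \val x *m q s.
have SUu (x : SU R 2) : \val x \is unitarymx by have /set_mem[] := valP x.
have y_cont : continuous y.
  apply: (@mulmx_continuous C (SU R 2) 2 2 2 (fun x => q r *m \val x) (fun=> q s)).
    apply: (@mulmx_continuous C (SU R 2) 2 2 2 (fun=> q r) (fun x => \val x)).
      exact: cst_continuous.
    exact: initial_continuous.
  exact: cst_continuous.
have yc : continuous (fun x => vecmx (y x)).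
  apply: (@mx_continuous C) => i j; rewrite (ord1 j).
  have [a [b ->]] : exists a b, i = @mxvec_index 2 2 a b.
    by have [a b] := @mxvec_indexP 2 2 i; exists a, b.
  rewrite (_ : (fun x => _) = fun x => y x a b).
    exact: (@entry_continuous C (SU R 2) 2 2 y a b y_cont).
  by apply/funext => x; rewrite mxE mxvecE.
rewrite (_ : (fun x => _) =
    fun x => 0 + 2^-1 *: (vecmx (y x) *m (vecmx (y x))^t*)); last first.
  apply/funext => x; rewrite add0r line_proj_mx_vecmx //.
  by rewrite /y pauli_row_orthonormal ?eqxx.
apply: (@lincombmx_continuous C); first exact: cst_continuous.
apply: (@mulmx_continuous C) => //; exact: (@adjmx_continuous C).
Qed.

Definition pauli r s : CSU2M4 R := mkcts (@pauli_continuous r s).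

Lemma CSU2M4_sumE (I : Type) (l : seq I) (F : I -> CSU2M4 R) (x : SU R 2) :
  (\sum_(i <- l) F i) x = \sum_(i <- l) F i x.
Proof.
elim: l => [|i l IH]; first by rewrite !big_nil.
by rewrite !big_cons -IH.
Qed.

Lemma pauli_partition (p : 'I_4 -> CSU2M4 R) (y : SU R 2 -> 'I_4 -> 'M[C]_2) :
  (forall x i j, hs_form (y x i) (y x j) = (i == j)%:R) ->
  (forall i x, p i x = line_proj_mx (y x i)) -> partition_of_unity p.
Proof.
move=> y1 pE; split.
- move=> i; split; apply: CSU2M4P => x.
    rewrite expr2 -[LHS]/(p i x *m p i x) pE line_proj_mx_mul //.
    by rewrite eqxx scale1r.
  by rewrite -[LHS]/((p i x)^t*) pE line_proj_mx_adj.
- move=> i j /negbTE ij; apply: CSU2M4P => x.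
  by rewrite -[LHS]/(p i x *m p j x) !pE line_proj_mx_mul // ij scale0r.
- apply: CSU2M4P => x; rewrite CSU2M4_sumE; under eq_bigr do rewrite pE.
  exact: sum_line_proj_mx.
Qed.

Lemma pauli_magic : magic_biunitary (\matrix_(r, s) pauli r s).
Proof.
have SUu (x : SU R 2) : \val x \is unitarymx by have /set_mem[] := valP x.
split=> [r|s].
  apply: (@pauli_partition _ (fun x s => q r *m \val x *m q s)).
    by move=> x i j; exact: pauli_row_orthonormal.
  by move=> s x; rewrite mxE.
apply: (@pauli_partition _ (fun x r => q r *m \val x *m q s)).
  by move=> x i j; exact: pauli_col_orthonormal.
by move=> r x; rewrite mxE.
Qed.

End PauliMagic.

(** * Separation and density *)

Local Open Scope classical_set_scope.

Section Separation.
Variables (K : fieldType) (V : lmodType K) (S : set (V -> K)).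
Hypothesis S_scalar : forall f, S f -> scalar f.
Hypothesis S0 : S (fun=> 0).
Hypothesis S_lin : forall c f g, S f -> S g -> S (fun a => c * f a + g a).
Hypothesis S_sep : forall a, (forall f, S f -> f a = 0) -> a = 0.

Let scalarB (f : V -> K) c a b : scalar f -> f (a - c *: b) = f a - c * f b.
Proof. by move=> fs; rewrite addrC -scaleNr fs mulNr addrC. Qed.

(** The first alternative is the dual form of [a] lying in the span of [l]. *)
Lemma separating_forms_alternative (l : seq V) a :
  (forall f, scalar f -> {in l, forall b, f b = 0} -> f a = 0) \/
  exists2 h, S h & {in l, forall b, h b = 0} /\ h a != 0.
Proof.
elim: l a => [|b l IH] a.
  have [a0|/existsNP[h /not_implyP[Sh ha]]] := pselect (forall f, S f -> f a = 0).
    left=> f fs _; rewrite (S_sep a0).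
    by have := fs (-1) 0 0; rewrite scaler0 addr0 mulN1r addNr.
  by right; exists h => //; split=> //; exact/eqP.
have [bl|[h0 Sh0 [h0l h0b]]] := IH b.
  have [al|[h Sh [hl ha]]] := IH a.
    by left=> f fs fl; apply: al => // c cl; apply: fl; rewrite inE cl orbT.
  right; exists h => //; split=> // c; rewrite inE => /orP[/eqP->|/hl//].
  by apply: bl => //; exact: S_scalar.
(* The corrected vector lies in the kernel of [h0]. Subtracting from [h] the multiple of [h0] that
   kills [b] gives a form whose value at [a] is that of [h] at the corrected vector. *)
have [al|[h Sh [hl ha]]] := IH (a - (h0 a / h0 b) *: b).
  left=> f fs fl; have fb : f b = 0 by apply: fl; rewrite inE eqxx.
  have := al f fs _; rewrite scalarB // fb mulr0 subr0; apply.
  by move=> c cl; apply: fl; rewrite inE cl orbT.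
right; exists (fun v => - (h b / h0 b) * h0 v + h v); first exact: S_lin.
split.
  move=> c; rewrite inE => /orP[/eqP->|cl].
    by rewrite mulNr divfK // addNr.
    by rewrite (h0l c) // (hl c) // mulr0 addr0.
move: ha; rewrite scalarB; last exact: S_scalar.
by apply: contra => /eqP e; apply/eqP; rewrite -e; ring.
Qed.

(** By induction on the list: if [a] depends on [l], the form found for [l] already agrees with [f]
    at [a]; otherwise a form killing [l] but not [a] corrects the value. *)
Lemma separating_forms_interpolate (f : V -> K) (l : seq V) : scalar f ->
  exists2 g, S g & {in l, forall a, g a = f a}.
Proof.
move=> fs; elim: l => [|a l [g Sg gl]]; first by exists (fun=> 0).
have [al|[h Sh [hl ha]]] := separating_forms_alternative l a.
  exists g => // b; rewrite inE => /orP[/eqP->|/gl//].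
  apply/eqP; rewrite -subr_eq0; apply/eqP.
  have gs := S_scalar Sg.
  apply: (al (fun v => g v - f v)) => [c u v|c cl]; last by rewrite gl ?subrr.
  by rewrite gs fs; ring.
exists (fun v => ((f a - g a) / h a) * h v + g v); first exact: S_lin.
move=> b; rewrite inE => /orP[/eqP->|bl]; first by rewrite divfK // subrK.
by rewrite (hl b) // mulr0 add0r gl.
Qed.

End Separation.

(** The functions in [S] that agree with [f] on a finite list form a filter base converging
    pointwise to [f]. *)
Lemma ptws_closure_interpolate (T : choiceType) (U : topologicalType)
    (S : set (T -> U)) (f : T -> U) :
  (forall l : seq T, exists2 g, S g & {in l, forall a, g a = f a}) ->
  @closure {ptws T -> U} S f.
Proof.
move=> Sf; pose B (l : seq T) := [set g : T -> U | S g /\ {in l, forall a, g a = f a}].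
pose F : set_system {ptws T -> U} := filter_from setT B.
have FF : ProperFilter F.
  apply: filter_from_proper; last first.
    by move=> l _; have [g Sg gl] := Sf l; exists g.
  apply: filter_from_filter; first by exists [::].
  move=> l l' _ _; exists (l ++ l') => // g [Sg gl].
  by split; split=> // a al; apply: gl; rewrite mem_cat al ?orbT.
have Ff : F --> (f : {ptws T -> U}).
  (* Pointwise convergence is tested at one argument at a time, where a list of length one
     suffices. *)
  apply/cvg_sup => a A; case=> O [[W Wo <-] Wf WA].
  exists [:: a] => // g [_ ga]; apply: WA; rewrite /preimage /=.
  by rewrite ga ?inE.
move=> A /Ff[l _ lA]; have [g Sg gl] := Sf l.
by exists g; split=> //; apply: lA.
Qed.

(** * The Pauli representation *)

Section Spanning.
Variables (R : realType) (A : starAlgType R) (u : 'M[A]_4).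
Hypothesis um : magic_biunitary u.

Lemma magic_row_partition : row_partition (fun r s => u r s).
Proof.
have [rows _] := um; split=> [r s s'|r]; last by have [_ _] := rows r.
have [proj orth _] := rows r; have [<-|ss'] := eqVneq s s'.
  by rewrite scale1r -expr2; have [] := proj s.
by rewrite orth // scale0r.
Qed.

Lemma star_fourier a b :
  star (fourier (fun r s => u r s) a b) = fourier (fun r s => u r s) a b.
Proof.
have star_sum (I : finType) (F : I -> A) : star (\sum_i F i) = \sum_i star (F i).
  apply: (big_morph (@star R A)); first exact: starD.
  by have := starZ (0 : R[i]) (0 : A); rewrite scale0r rmorph0 scale0r.
rewrite /fourier starZ fmorphV rmorph_nat; congr (_ *: _).
rewrite star_sum; apply: eq_bigr => r _; rewrite star_sum; apply: eq_bigr => s _.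
have [rows _] := um; have [proj _ _] := rows r; have [_ sE] := proj s.
by rewrite starZ rmorphM !rmorph_sign sE.
Qed.

(** Combinations of words form a unital *-subalgebra, the involution reversing words of self-adjoint
    letters; it contains the entries of [u] by Fourier inversion. *)
Lemma word_combinations (a : A) :
  smallest (@unital_star_subalgebra R A)
    [set u ij.1 ij.2 | ij in [set: 'I_4 * 'I_4]] a ->
  exists r : seq (R[i] * seq ('I_4 * 'I_4)),
    a = \sum_(z <- r) z.1 *: word_val (fourier (fun r s => u r s)) z.2.
Proof.
set x := fourier _.
pose W : set A := [set a | exists r : seq (R[i] * seq ('I_4 * 'I_4)),
  a = \sum_(z <- r) z.1 *: word_val x z.2].
move=> ua; suff /(_ _ ua) : smallest (@unital_star_subalgebra R A)
    [set u ij.1 ij.2 | ij in [set: 'I_4 * 'I_4]] `<=` W by [].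
have W1 c s : W (c *: word_val x s) by exists [:: (c, s)]; rewrite big_seq1.
have WD (c : R[i]) b d : W b -> W d -> W (c *: b + d).
  move=> [r ->] [r' ->]; exists ([seq (c * z.1, z.2) | z <- r] ++ r').
  rewrite big_cat big_map scaler_sumr; congr (_ + _).
  by apply: eq_bigr => z _; rewrite scalerA.
have W0 : W 0 by exists [::]; rewrite big_nil.
have WS (I : Type) (l : seq I) (F : I -> A) :
    (forall i, W (F i)) -> W (\sum_(i <- l) F i).
  move=> WF; elim: l => [|i l IH]; first by rewrite big_nil.
  by rewrite big_cons -[F i]scale1r; exact: WD.
apply: smallest_sub; first split=> //.
- by have := W1 1 [::]; rewrite /word_val big_nil scale1r.
- move=> _ _ [r ->] [r' ->]; rewrite mulr_suml; apply: (WS) => z.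
  rewrite mulr_sumr; apply: (WS) => z'.
  by rewrite -scalerAl -scalerAr scalerA /word_val -big_cat; exact: W1.
- move=> _ [r ->].
  have star_word s : star (word_val x s) = word_val x (rev s).
    rewrite /word_val; elim: s => [|p s IH].
      by rewrite !big_nil -[LHS]mulr1 -[X in _ * X]starK -starM mulr1 starK.
    by rewrite !big_cons rev_cons -cats1 big_cat big_seq1 starM IH star_fourier.
  have -> : star (\sum_(z <- r) z.1 *: word_val x z.2) =
      \sum_(z <- r) z.1^* *: word_val x (rev z.2).
    rewrite (big_morph (@star R A) (@starD R A) (_ : star 0 = 0)).
      by apply: eq_bigr => z _; rewrite starZ star_word.
    by have := starZ (0 : R[i]) (0 : A); rewrite scale0r rmorph0 scale0r.
  by apply: WS.
- move=> _ [[r s] _ <-] /=; rewrite (fourierK (fun r s => u r s)) scaler_sumr.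
  apply: (WS) => a'; rewrite scaler_sumr; apply: (WS) => b'.
  have := W1 (4^-1 * (sgn4 R[i] a' r * sgn4 R[i] b' s)) [:: (a', b')].
  by rewrite /word_val big_seq1 -(scalerA 4^-1).
Qed.

End Spanning.

Lemma cstar_dual_lin (R : realType) (B : cstarAlgType R) (c : R[i]) f g :
  @cstar_dual R B f -> @cstar_dual R B g ->
  @cstar_dual R B (fun b => c * f b + g b).
Proof.
move=> [fs [M fM]] [gs [N gN]]; split.
  by move=> k a b; rewrite fs gs; ring.
exists (Normc.normc c * M + N) => b; rewrite -lecR -Defs.normcE mulrDl.
apply: (le_trans (ler_normD _ _)); rewrite rmorphD /=; apply: lerD.
  by rewrite normrM !Defs.normcE -rmorphM lecR -mulrA ler_wpM2l ?normc_ge0.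
by rewrite Defs.normcE lecR.
Qed.

(** The operator norm dominates each entry. These forms separate the points of the function
    algebra. *)
Lemma CSU2M4_entry_dual (R : realType) (x : SU R 2) i j :
  @cstar_dual R (CSU2M4 R) (fun f => f x i j).
Proof.
split=> [c f g|]; last first.
  exists 1 => f; rewrite mul1r.
  exact: le_trans (opnorm_entry _ _ _) (supnorm_ub _ _).
have -> : (c *: f + g) x = c *: f x + g x by [].
by rewrite !mxE.
Qed.

Lemma injective_inner_faithful (R : realType) (H : hopfCstar R)
    (pi : H -> CSU2M4 R) : linear pi ->
  (forall a : halg H, pi (hincl a) = 0 -> a = 0) -> inner_faithful pi.
Proof.
move=> pil piK f fs; have [hl _ _] := hincl_hom H.
apply: ptws_closure_interpolate => l.
have [||||g Sg gl] := @separating_forms_interpolate _ _ (coefficients pi) _ _ _ _ f l fs.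
- move=> _ [phi [phis _] <-] c a b.
  by rewrite hl pil phis.
- exists (fun=> 0) => //; split; first by move=> c a b; rewrite mulr0 addr0.
  by exists 0 => b; rewrite Normc.normc0 mul0r.
- move=> c _ _ [phi phiD <-] [psi psiD <-].
  by exists (fun b => c * phi b + psi b) => //; exact: cstar_dual_lin.
- move=> a a0; apply: piK; apply: CSU2M4P => x; apply/matrixP => i j.
  rewrite (a0 _ (ex_intro2 _ _ _ (CSU2M4_entry_dual x i j) erefl)).
  by rewrite -[RHS]/((0 : 'M[_]_4) i j) mxE.
by exists g => //; exact: sub_gen_smallest.
Qed.

(** The magic relations are equations, which an injective *-morphism reflects; this brings them from
    the C*-algebra to its dense subalgebra. *)
Lemma magic_biunitary_pullback (R : realType) (A B : starAlgType R) (f : A -> B) n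
    (u : 'M[A]_n) : star_hom f -> injective f ->
  magic_biunitary (map_mx f u) -> magic_biunitary u.
Proof.
move=> [fl [f1 fM] fstar] f_inj [rows cols].
have f0 : f 0 = 0 by have := fl (-1) 0 0; rewrite scaler0 addr0 scaleN1r addNr.
have fD a b : f (a + b) = f a + f b by have := fl 1 a b; rewrite !scale1r.
have pullback (p : 'I_n -> A) :
    partition_of_unity (fun i => f (p i)) -> partition_of_unity p.
  move=> [proj orth sum1]; split.
  - move=> i; have [pp sp] := proj i; split; apply: f_inj.
      by rewrite expr2 fM -expr2.
    by rewrite fstar.
  - by move=> i j /orth pp; apply: f_inj; rewrite fM pp f0.
  - by apply: f_inj; rewrite f1 -sum1 (big_morph f fD f0).
split=> i; apply: pullback.
  by have := rows i; under eq_fun do rewrite mxE.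
by have := cols i; under eq_fun do rewrite mxE.
Qed.

Lemma rotationZ (D : comNzRingType) (c : D) w a b :
  rotation (fun i => c * w i) a b = c ^+ 2 * rotation w a b.
Proof.
by elim/ord4P: a; elim/ord4P: b; rewrite /rotation /= ?mulr0 //; ring.
Qed.

(** * Points of SU(2) with rational rotation coefficients *)

Section PauliPoints.
Variables (R : realType) (n : 'I_4 -> nat).
Let w (a : 'I_4) : R := (n a).+1%:R.

Let N0 : 0 < rotation w o0 o0.
Proof.
rewrite /rotation /=; do 3 ![apply: ltr_pwDl; last exact: sqr_ge0].
by rewrite exprn_gt0 // ltr0n.
Qed.

(* Dividing by the norm gives a point of SU(2) for every positive integral
   quadruple. *)
Definition pauli_point : 'M[R[i]]_2 :=
  quat_comb (fun a => (Num.sqrt (rotation w o0 o0))^-1 * w a).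

(** The square root disappears because [rotation] is homogeneous of degree 2. *)
Let sqrN a b : rotation (fun a => (Num.sqrt (rotation w o0 o0))^-1 * w a) a b =
  rotation w a b / rotation w o0 o0.
Proof. by rewrite rotationZ exprVn sqr_sqrtr ?ltW // mulrC. Qed.

Lemma pauli_point_SU : SU R 2 pauli_point.
Proof. by apply: quat_comb_unitary; rewrite sqrN divff // gt_eqF. Qed.

Lemma pauli_point_conj a :
  let k := rotation (fun a => (n a).+1%:R : R[i]) in
  pauli_point^t* *m (tnth (quat R) a)^t* *m pauli_point =
  \sum_b (k a b / k o0 o0) *: (tnth (quat R) b)^t*.
Proof.
move=> k; rewrite quat_comb_conj; apply: eq_bigr => b _; congr (_ *: _).
have kE c d : k c d = (rotation w c d)%:C%C.
  rewrite (rotation_map (real_complex R)); apply: eq_rotation => i.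
  by rewrite /= /w rmorph_nat.
by rewrite sqrN !kE fmorph_div.
Qed.

End PauliPoints.

(** Evaluating [pi a = 0] at the points built from integral quadruples gives exactly the hypothesis
    of [magic_coeffs_separation]. *)
Lemma pauli_separation (R : realType) (A : starAlgType R) (u : 'M[A]_4)
    (pi : A -> CSU2M4 R) : magic_biunitary u -> linear pi -> monoid_morphism pi ->
  (forall r s, pi (u r s) = pauli R r s) ->
  forall a, smallest (@unital_star_subalgebra R A)
    [set u ij.1 ij.2 | ij in [set: 'I_4 * 'I_4]] a -> pi a = 0 -> a = 0.
Proof.
move=> um pil [pi1 piM] piu a /(word_combinations um)[r ->].
set x := fourier _ => pia0.
have xm : magic_coeffs x.
  apply: fourier_magic; first exact: magic_row_partition.
  have [rows cols] := um.
  have um' : magic_biunitary u^T.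
    by split=> i; under eq_fun do rewrite mxE; [exact: cols | exact: rows].
  have [orth sum1] := magic_row_partition um'; split=> [i j k|i].
    by have := orth i j k; rewrite !mxE.
  by have := sum1 i; under eq_bigr do rewrite mxE.
apply: (magic_coeffs_separation (endo_lmul_units R) (endo_rmul_units R)
  (@endo_lrmulC R) xm) => n k.
pose p : SU R 2 :=
  exist (fun x => x \in SU R 2) (pauli_point R n) (mem_set (pauli_point_SU R n)).
pose rho b := pi b p.
have rhoD c b d : rho (c *: b + d) = c *: rho b + rho d by rewrite /rho pil.
have rhoM b d : rho (b * d) = rho b * rho d by rewrite /rho piM.
have rho1 : rho 1 = 1 by rewrite /rho pi1.
have rho0 : rho 0 = 0.
  by have := rhoD (-1) 0 0; rewrite scaler0 addr0 scaleN1r addNr.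
have rhoS (I : Type) (l : seq I) (F : I -> A) :
    rho (\sum_(i <- l) F i) = \sum_(i <- l) rho (F i).
  apply: (big_morph rho) => // b d.
  by have := rhoD 1 b d; rewrite !scale1r.
have rhoZ c b : rho (c *: b) = c *: rho b.
  by rewrite -[c *: b]addr0 rhoD rho0 addr0.
(* The values [rho (u r s)] are line projections with a known Fourier expansion, from which their
   transform is read off. *)
have rhox a' b' : rho (x a' b') = (k a' b' / k o0 o0) *:
    (endo_mx (mulmx (tnth (quat R) a')) * endo_mx (mulmxr ((tnth (quat R) b')^t*))).
  transitivity (fourier (fun r s => rho (u r s)) a' b').
    rewrite /x /fourier rhoZ rhoS; congr (_ *: _); apply: eq_bigr => i _.
    by rewrite rhoS; apply: eq_bigr => j _; rewrite rhoZ.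
  apply: (@fourier_inj_sum _ _ _ (fun a b => (k a b / k o0 o0) *:
    (endo_mx (mulmx (tnth (quat R) a)) *
     endo_mx (mulmxr ((tnth (quat R) b)^t*))))) => i j; rewrite /rho piu.
  rewrite -[LHS]/(line_proj_mx (tnth (quat R) i *m pauli_point R n *m tnth (quat R) j)).
  apply: line_proj_mx_quat; first by have [] := pauli_point_SU R n.
  exact: pauli_point_conj.
rewrite -[RHS]/((0 : CSU2M4 R) p) -pia0 -/(rho _) rhoS; apply: eq_bigr => z _.
rewrite rhoZ; congr (_ *: _).
rewrite /word_val; elim: (z.2) => [|d s IH]; first by rewrite !big_nil rho1.
by rewrite !big_cons rhoM rhox IH.
Qed.

Theorem theorem3p1 (R : realType) (H : hopfCstar R) (u : 'M[halg H]_4)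
    (Hu : is_A_aut u) :
  exists pi : H -> CSU2M4 R,
    [/\ star_hom pi, inner_faithful pi &
        forall (r s : 'I_4) (x : SU R 2),
          pi (hincl (u r s)) x =
          line_proj_mx (tnth (quat R) r *m \val x *m tnth (quat R) s)].
Proof.
have [[um univ] gen _ _ _] := Hu.
have [pi [[pi_hom piE] _]] := univ (CSU2M4 R) _ (pauli_magic R).
have piu r s : pi (hincl (u r s)) = pauli R r s.
  by move/matrixP: piE => /(_ r s); rewrite !mxE.
have um' := magic_biunitary_pullback (hincl_hom H) (@hincl_inj R H) um.
have [hl [h1 hM] _] := hincl_hom H; have [pil [pi1 piM] _] := pi_hom.
exists pi; split=> //; last by move=> r s x; rewrite piu.
apply: injective_inner_faithful => // a.
apply: (@pauli_separation R (halg H) u (pi \o hincl)) => //=.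
- by move=> c b d; rewrite /= hl pil.
- by split=> [|b d] /=; rewrite ?h1 ?pi1 // hM piM.
- by rewrite gen.
Qed.
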